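(* Let $\Gamma$ be an environment and $M$ a term such that the judgement $\Gamma\vdash M$ is well formed. If $[\mathcal{Q},\mathcal{QV},M]\to[\mathcal{Q}',\mathcal{QV}',M']$, then the judgement $\Gamma,(\mathcal{QV}'-\mathcal{QV})\vdash M'$ is well formed, where $\mathcal{QV}'-\mathcal{QV}$ (the set of quantum variables created by the reduction) is added to the environment as quantum variables.
   Context: The Q-calculus. Fix an effective enumeration $(\mathbf{U}_i)_{i<\omega}$ of computable unitary operators $\mathbf{U}_i:\mathbb{C}^{2^{n_i}}\to\mathbb{C}^{2^{n_i}}$, and associate to each a constant symbol $U_i$. Terms are given by: classical variables $x$; quantum variables $r$; patterns $\pi::=x\mid\langle x_1,\dots,x_n\rangle$; constants $C::=0\mid 1\mid U_i$; terms $M::=x\mid r\mid\ !M\mid C\mid \mathtt{new}(M)\mid (M_1)M_2\mid\langle M_1,\dots,M_n\rangle\ (n\ge2)\mid \lambda!x.M\mid\lambda\pi.M$, taken modulo $\alpha$-conversion; $M\{N/x\}$ is capture-avoiding substitution. $\mathrm{Q}(M)$ denotes the set of quantum variables occurring in $M$. An environment is a multiset consisting of patterns, items $!x$ ($x$ classical) and quantum variables, in which each variable name occurs at most once; $!\Gamma$ denotes $!x_1,\dots,!x_n$ when $\Gamma=x_1,\dots,x_n$. A judgement $\Gamma\vdash M$ is well formed if derivable by the rules: $\vdash C$; $r\vdash r$; $x\vdash x$; from $\Gamma\vdash M$ infer $\Gamma,!x\vdash M$; from $\Gamma,!x,!y\vdash M$ infer $\Gamma,!z\vdash M\{z/x,z/y\}$;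 from $!\Gamma\vdash M$ infer $!\Gamma\vdash !M$; from $\Gamma,x\vdash M$ infer $\Gamma,!x\vdash M$; from $\Gamma,x_1,\dots,x_k\vdash M$ infer $\Gamma,\langle x_1,\dots,x_k\rangle\vdash M$; from $\Gamma_1\vdash M_1,\dots,\Gamma_k\vdash M_k$ infer $\Gamma_1,\dots,\Gamma_k\vdash\langle M_1,\dots,M_k\rangle$; from $\Gamma\vdash M$ infer $\Gamma\vdash\mathtt{new}(M)$; from $\Gamma,\pi\vdash M$ infer $\Gamma\vdash\lambda\pi.M$; from $\Gamma,!x\vdash M$ infer $\Gamma\vdash\lambda!x.M$; from $\Gamma_1\vdash M_1$ and $\Gamma_2\vdash M_2$ infer $\Gamma_1,\Gamma_2\vdash(M_1)M_2$. A term $M$ is well formed if $\mathrm{Q}(M)\vdash M$ is well formed. Quantum registers: for a finite set $V$ of quantum variables, $\mathcal{H}(V)$ is the Hilbert space of functions $\{0,1\}^V\to\mathbb{C}$ with standard orthonormal basis $\{|f\rangle: f\in\{0,1\}^V\}$; for disjoint $V,V'$ one identifies $\mathcal{H}(V)\otimes\mathcal{H}(V')$ with $\mathcal{H}(V\cup V')$. A quantum register is a unit vector of $\mathcal{H}(V)$. For $\mathbf{U}:\mathbb{C}^{2^n}\to\mathbb{C}^{2^n}$ and distinct $r_1,\dots,r_n\in V$, $\mathbf{U}_{\langle\langle r_1,\dots,r_n\rangle\rangle}$ is the operator on $\mathcal{H}(V)$ acting as $\mathbf{U}$ on the qubits $r_1,\dots,r_n$ (in this order) and as the identity on the others. A preconfiguration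 is a triple $[\mathcal{Q},\mathcal{QV},M]$ with $\mathcal{QV}$ a finite set of quantum variables, $\mathcal{Q}\in\mathcal{H}(\mathcal{QV})$ and $\mathrm{Q}(M)\subseteq\mathcal{QV}$; a configuration is an equivalence class of preconfigurations modulo bijective renaming of quantum variables (applied to both $\mathcal{Q}$ and $M$). A configuration is well formed if $\Gamma\vdash M$ is well formed for some $\Gamma$. Reduction $\xrightarrow{\alpha}$ (label $\alpha$) is defined on well-formed configurations by the axioms: ($\mathsf{Uq}$) $[\mathcal{Q},\mathcal{QV},U\langle r_1,\dots,r_n\rangle]\to[\mathbf{U}_{\langle\langle r_1,\dots,r_n\rangle\rangle}\mathcal{Q},\mathcal{QV},\langle r_1,\dots,r_n\rangle]$ where $\mathbf{U}$ acts on $\mathbb{C}^{2^n}$; ($\mathsf{new}$) $[\mathcal{Q},\mathcal{QV},\mathtt{new}(c)]\to[\mathcal{Q}\otimes|r\mapsto c\rangle,\mathcal{QV}\cup\{r\},r]$ for $c\in\{0,1\}$, $r$ fresh; ($\mathsf{l.\beta}$) $(\lambda x.M)N\to M\{N/x\}$; ($\mathsf{q.\beta}$) $(\lambda\langle x_1,\dots,x_n\rangle.M)\langle r_1,\dots,r_n\rangle\to M\{r_1/x_1,\dots,r_n/x_n\}$; ($\mathsf{c.\beta}$) $(\lambda!x.M)!N\to M\{N/x\}$; ($\mathsf{l.cm}$) $L((\lambda\pi.M)N)\to(\lambda\pi.LM)N$; ($\mathsf{r.cm}$) $((\lambda\pi.M)N)L\to(\lambda\pi.ML)N$ (the last five leave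 $\mathcal{Q},\mathcal{QV}$ unchanged); closed under the contexts: a component of a tuple, the left or the right side of an application, and the body of $\lambda\pi.(\cdot)$ (the label is preserved; no reduction inside $!M$). $\to$ is the union of all $\xrightarrow{\alpha}$. *)

(* Defs.v *)
From Stdlib Require Import List Permutation.
From HB Require Import structures.
From mathcomp Require Import all_boot all_order all_algebra.
From mathcomp Require Import finmap.
From mathcomp Require Import complex.
From mathcomp Require Import reals.

Set Implicit Arguments.
Unset Strict Implicit.
Unset Printing Implicit Defensive.

Import Order.TTheory GRing.Theory Num.Theory.

Local Open Scope nat_scope.

Notation cvar := nat (only parsing).
Notation qvar := nat (only parsing).

(** * Terms modulo alpha-conversion

    Locally nameless syntax: free variables carry names, bound variables are
    de Bruijn indices, so that alpha-equivalent terms are equal.  A binder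
    [Lam s] binds [arity s] indices at once, the component number [i] of the
    pattern being index [i].  Only elements satisfying [is_term 0] are terms
    of the calculus; the others have dangling indices or violate the
    arity constraints of the grammar. *)

Inductive pattern : Type :=
| PVar (x : cvar)
| PTup (xs : seq cvar).

Definition pvars (p : pattern) : seq cvar :=
  match p with PVar x => [:: x] | PTup xs => xs end.

Definition is_pattern (p : pattern) : bool :=
  (pvars p != [::]) && uniq (pvars p).

(* A pattern without the names of its variables. *)
Inductive shape : Type :=
| SVar
| STup (n : nat).

Definition shape_of (p : pattern) : shape :=
  match p with PVar _ => SVar | PTup xs => STup (size xs) end.

Definition arity (s : shape) : nat :=
  match s with SVar => 1 | STup n => n end.

Inductive term : Type :=
| BVar (i : nat)
| Var (x : cvar)
| QVar (r : qvar)
| Bang (M : term)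
| Bit (b : bool)
| Gate (i : nat)
| New (M : term)
| App (M N : term)
| Tup (Ms : seq term)
| LamBang (M : term)
| Lam (s : shape) (M : term).

Fixpoint is_term (k : nat) (M : term) : bool :=
  match M with
  | BVar i => i < k
  | Var _ | QVar _ | Bit _ | Gate _ => true
  | Bang M | New M => is_term k M
  | App M N => is_term k M && is_term k N
  | Tup Ms => (1 < size Ms) && all (is_term k) Ms
  | LamBang M => is_term k.+1 M
  | Lam s M => (0 < arity s) && is_term (k + arity s) M
  end.

(* Free classical variables. *)
Fixpoint fv (M : term) : seq cvar :=
  match M with
  | Var x => [:: x]
  | BVar _ | QVar _ | Bit _ | Gate _ => [::]
  | Bang M | New M | LamBang M | Lam _ M => fv M
  | App M N => fv M ++ fv N
  | Tup Ms => flatten (map fv Ms)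
  end.

(* Quantum variables; no binder binds them. *)
Fixpoint qv (M : term) : seq qvar :=
  match M with
  | QVar r => [:: r]
  | BVar _ | Var _ | Bit _ | Gate _ => [::]
  | Bang M | New M | LamBang M | Lam _ M => qv M
  | App M N => qv M ++ qv N
  | Tup Ms => flatten (map qv Ms)
  end.

(* Turns the free variables [xs] into the indices [k, k + 1, ...]. *)
Fixpoint close (k : nat) (xs : seq cvar) (M : term) : term :=
  match M with
  | Var x => if x \in xs then BVar (k + index x xs) else Var x
  | BVar _ | QVar _ | Bit _ | Gate _ => M
  | Bang M => Bang (close k xs M)
  | New M => New (close k xs M)
  | App M N => App (close k xs M) (close k xs N)
  | Tup Ms => Tup (map (close k xs) Ms)
  | LamBang M => LamBang (close k.+1 xs M)
  | Lam s M => Lam s (close (k + arity s) xs M)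
  end.

(* The alpha-classes of lambda p.M and lambda !x.M, for a term M. *)
Definition lam (p : pattern) (M : term) : term :=
  Lam (shape_of p) (close 0 (pvars p) M).

Definition lam_bang (x : cvar) (M : term) : term :=
  LamBang (close 0 [:: x] M).

(* Simultaneous substitution M{N1/x1, ..., Nn/xn}, for distinct xs.  The
   substituted terms have no dangling index, hence there is no capture. *)
Fixpoint subst (xs : seq cvar) (Ns : seq term) (M : term) : term :=
  match M with
  | Var x => nth (Var x) Ns (index x xs)
  | BVar _ | QVar _ | Bit _ | Gate _ => M
  | Bang M => Bang (subst xs Ns M)
  | New M => New (subst xs Ns M)
  | App M N => App (subst xs Ns M) (subst xs Ns N)
  | Tup Ms => Tup (map (subst xs Ns) Ms)
  | LamBang M => LamBang (subst xs Ns M)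
  | Lam s M => Lam s (subst xs Ns M)
  end.

(* The term <M1, ..., Mn>, with the convention that <M> is M, tuples proper
   having at least two components. *)
Definition tuple_term (Ms : seq term) : term :=
  match Ms with [:: M] => M | _ => Tup Ms end.

(** * Environments and well-formed judgements *)

Inductive env_item : Type :=
| EPat (p : pattern)
| EBang (x : cvar)
| EQ (r : qvar).

(* Multisets are represented by sequences, [wf] being closed under
   permutation. *)
Definition env : Type := seq env_item.

Definition item_cvars (e : env_item) : seq cvar :=
  match e with EPat p => pvars p | EBang x => [:: x] | EQ _ => [::] end.

Definition item_qvars (e : env_item) : seq qvar :=
  match e with EQ r => [:: r] | _ => [::] end.

Definition is_env (G : env) : bool :=
  uniq (flatten (map item_cvars G)) && uniq (flatten (map item_qvars G)).

Definition lin (x : cvar) : env_item := EPat (PVar x).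

(* [wf G M]: the judgement G |- M is well formed. *)
Inductive wf : env -> term -> Prop :=
| wf_exchange G G' M :
    Permutation G G' -> wf G M -> wf G' M
| wf_bit b : wf [::] (Bit b)
| wf_gate i : wf [::] (Gate i)
| wf_qvar r : wf [:: EQ r] (QVar r)
| wf_var x : wf [:: lin x] (Var x)
| wf_weak G x M :
    is_env (EBang x :: G) ->
    wf G M -> wf (EBang x :: G) M
| wf_contr G x y z M :
    is_env (EBang z :: G) ->
    wf (EBang x :: EBang y :: G) M ->
    wf (EBang z :: G) (subst [:: x; y] [:: Var z; Var z] M)
| wf_prom xs M :
    wf (map EBang xs) M -> wf (map EBang xs) (Bang M)
| wf_der G x M :
    wf (lin x :: G) M -> wf (EBang x :: G) M
| wf_pat G xs M :
    xs <> [::] ->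
    wf (map lin xs ++ G) M -> wf (EPat (PTup xs) :: G) M
| wf_tuple Gs Ms :
    1 < size Ms ->
    is_env (flatten Gs) ->
    Forall2 wf Gs Ms -> wf (flatten Gs) (Tup Ms)
| wf_new G M :
    wf G M -> wf G (New M)
| wf_lam G p M :
    wf (EPat p :: G) M -> wf G (lam p M)
| wf_lam_bang G x M :
    wf (EBang x :: G) M -> wf G (lam_bang x M)
| wf_app G1 G2 M1 M2 :
    is_env (G1 ++ G2) ->
    wf G1 M1 -> wf G2 M2 -> wf (G1 ++ G2) (App M1 M2).

(** * Quantum registers *)

Local Open Scope fset_scope.
Local Open Scope ring_scope.

Section Registers.
Variable R : realType.

(* H(V), a vector being given by its coordinates in the basis
   { |f> : f in {0,1}^V }. *)
Definition hilbert (V : {fset qvar}) : Type :=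
  {ffun {ffun V -> bool} -> R[i]}.

Definition ket (V : {fset qvar}) (f : {ffun V -> bool}) : hilbert V :=
  [ffun g => (g == f)%:R].

Definition restrict (V W : {fset qvar}) (sVW : V `<=` W)
    (f : {ffun W -> bool}) : {ffun V -> bool} :=
  [ffun v => f (fincl sVW v)].

(* The image of Q (x) Q' under the identification of H(V) (x) H(V') with
   H(V u V'), for disjoint V and V'. *)
Definition tensor (V V' : {fset qvar}) (Q : hilbert V) (Q' : hilbert V') :
    hilbert (V `|` V') :=
  [ffun f => Q (restrict (fsubsetUl V V') f) *
             Q' (restrict (fsubsetUr V V') f)].

(* |r |-> c> *)
Definition ket1 (r : qvar) (c : bool) : hilbert [fset r] :=
  ket [ffun=> c].

(* The number whose binary expansion is [b], most significant bit first. *)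
Definition bits_val (b : seq bool) : nat :=
  foldl (fun (a : nat) (c : bool) => a.*2 + c)%N 0%N b.

Lemma bits_val_lt (n : nat) (b : n.-tuple bool) : (bits_val b < 2 ^ n)%N.
Proof.
rewrite -{2}(size_tuple b); elim/last_ind: {b}(val b) => [|s c IHs] //.
rewrite /bits_val foldl_rcons -/(bits_val s) size_rcons expnS mul2n.
by case: c; rewrite ?addn1 ?addn0 ?ltn_double // -doubleS leq_double.
Qed.

(* Position of |b1 ... bn> in the standard basis of C^(2^n). *)
Definition bits_ord (n : nat) (b : n.-tuple bool) : 'I_(2 ^ n) :=
  Ordinal (bits_val_lt b).

Definition update (V : {fset qvar}) (n : nat) (rs : n.-tuple V)
    (b : n.-tuple bool) (f : {ffun V -> bool}) : {ffun V -> bool} :=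
  [ffun v => if v \in rs then nth false b (index v rs) else f v].

(* U_<<r1, ..., rn>> Q: the coordinate at f is the sum over b in {0,1}^n of
   U_{f(r1)...f(rn), b} * Q(f[r1 := b1, ..., rn := bn]). *)
Definition gate_apply (V : {fset qvar}) (n : nat) (U : 'M[R[i]]_(2 ^ n))
    (rs : n.-tuple V) (Q : hilbert V) : hilbert V :=
  [ffun f : {ffun V -> bool} => \sum_(b : n.-tuple bool)
     U (bits_ord (map_tuple f rs)) (bits_ord b) * Q (update rs b f)].

End Registers.

(** * Effective enumerations of computable unitary operators *)

(* Codes of partial recursive functions. *)
Inductive code : Type :=
| CZero
| CSucc
| CProj (i : nat)
| CComp (f : code) (gs : seq code)
| CPrec (f g : code)
| CMu (f : code).

Inductive eval : code -> seq nat -> nat -> Prop :=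
| eval_zero xs : eval CZero xs 0
| eval_succ x : eval CSucc [:: x] x.+1
| eval_proj i xs : (i < size xs)%N -> eval (CProj i) xs (nth 0%N xs i)
| eval_comp f gs xs ys z :
    Forall2 (fun g y => eval g xs y) gs ys -> eval f ys z ->
    eval (CComp f gs) xs z
| eval_prec0 f g xs z :
    eval f xs z -> eval (CPrec f g) (0%N :: xs) z
| eval_precS f g n xs y z :
    eval (CPrec f g) (n :: xs) y -> eval g (n :: y :: xs) z ->
    eval (CPrec f g) (n.+1 :: xs) z
| eval_mu f xs n :
    (forall m, (m < n)%N -> exists k, eval f (m :: xs) k.+1) ->
    eval f (n :: xs) 0 -> eval (CMu f) xs n.

(* [f], restricted to arguments of length [m], is a recursive function. *)
Definition recursive (m : nat) (f : seq nat -> nat) : Prop :=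
  exists c : code, forall xs, size xs = m -> eval c xs (f xs).

(* The reals [E i j l] are computable uniformly in i, j, l: a recursive
   function yields, for every k, a dyadic approximation up to 2^-k. *)
Definition computable_entries (R : realType) (n : nat -> nat)
    (E : forall i, 'I_(2 ^ n i) -> 'I_(2 ^ n i) -> R) : Prop :=
  exists a b : seq nat -> nat,
    [/\ recursive 4 a, recursive 4 b &
        forall i (j l : 'I_(2 ^ n i)) (k : nat),
          `| E i j l - ((a [:: i; val j; val l; k])%:R -
                        (b [:: i; val j; val l; k])%:R) / 2 ^+ k |
            <= 2 ^- k].

(* (U_i) is an effective enumeration of computable unitary operators
   U_i : C^(2^n_i) -> C^(2^n_i), given by their matrices. *)
Definition effective_unitaries (R : realType) (n : nat -> nat)
    (U : forall i, 'M[R[i]]_(2 ^ n i)) : Prop :=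
  [/\ forall i, U i \is unitarymx,
      recursive 1 (fun xs => n (head 0%N xs)),
      computable_entries (fun i j l => complex.Re (U i j l)) &
      computable_entries (fun i j l => complex.Im (U i j l))].

(** * Reduction *)

Record preconf (R : realType) : Type := Preconf {
  pc_vars : {fset qvar};
  pc_reg : hilbert R pc_vars;
  pc_term : term
}.
Arguments Preconf {R} pc_vars pc_reg pc_term.

(* A well-formed preconfiguration: Q(M) is included in QV and G |- M is well
   formed for some G. *)
Definition wf_preconf (R : realType) (C : preconf R) : Prop :=
  {subset qv (pc_term C) <= pc_vars C} /\ exists G, wf G (pc_term C).

Inductive label : Type := Uq | Lnew | Lbeta | Qbeta | Cbeta | Lcm | Rcm.

Section Reduction.
Variables (R : realType) (n : nat -> nat) (U : forall i, 'M[R[i]]_(2 ^ n i)).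

(* Reduction acts on representatives of configurations.  The premises
   [is_term 0 M] say that M is a term, and [is_pattern p] that p is a
   pattern; the disjointness premises of the commutation rules express that
   the variables of p, which are bound, are chosen not to capture those of L. *)
Inductive step : label -> preconf R -> preconf R -> Prop :=
| step_Uq i (QV : {fset qvar}) (Q : hilbert R QV)
    (rs : (n i).-tuple QV) :
    uniq rs ->
    step Uq (Preconf QV Q
               (App (Gate i) (tuple_term [seq QVar (val r) | r <- rs])))
            (Preconf QV (gate_apply (U i) rs Q)
               (tuple_term [seq QVar (val r) | r <- rs]))
| step_new (QV : {fset qvar}) (Q : hilbert R QV) (c : bool) (r : qvar) :
    r \notin QV ->
    step Lnew (Preconf QV Q (New (Bit c)))
              (Preconf (QV `|` [fset r]) (tensor Q (ket1 R r c)) (QVar r))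
| step_lbeta QV Q x M N :
    is_term 0 M -> is_term 0 N ->
    step Lbeta (Preconf QV Q (App (lam (PVar x) M) N))
               (Preconf QV Q (subst [:: x] [:: N] M))
| step_qbeta QV Q (xs : seq cvar) (rs : seq qvar) M :
    is_pattern (PTup xs) -> size rs = size xs -> is_term 0 M ->
    step Qbeta
      (Preconf QV Q (App (lam (PTup xs) M) (tuple_term (map QVar rs))))
      (Preconf QV Q (subst xs (map QVar rs) M))
| step_cbeta QV Q x M N :
    is_term 0 M -> is_term 0 N ->
    step Cbeta (Preconf QV Q (App (lam_bang x M) (Bang N)))
               (Preconf QV Q (subst [:: x] [:: N] M))
| step_lcm QV Q p L M N :
    is_pattern p -> ~~ has (mem (fv L)) (pvars p) ->
    is_term 0 L -> is_term 0 M -> is_term 0 N ->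
    step Lcm (Preconf QV Q (App L (App (lam p M) N)))
             (Preconf QV Q (App (lam p (App L M)) N))
| step_rcm QV Q p L M N :
    is_pattern p -> ~~ has (mem (fv L)) (pvars p) ->
    is_term 0 L -> is_term 0 M -> is_term 0 N ->
    step Rcm (Preconf QV Q (App (App (lam p M) N) L))
             (Preconf QV Q (App (lam p (App M L)) N))
| step_tuple a QV Q M QV' Q' M' (Ms Ns : seq term) :
    is_term 0 (Tup (Ms ++ M :: Ns)) ->
    step a (Preconf QV Q M) (Preconf QV' Q' M') ->
    step a (Preconf QV Q (Tup (Ms ++ M :: Ns)))
           (Preconf QV' Q' (Tup (Ms ++ M' :: Ns)))
| step_appl a QV Q M QV' Q' M' N :
    is_term 0 N ->
    step a (Preconf QV Q M) (Preconf QV' Q' M') ->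
    step a (Preconf QV Q (App M N)) (Preconf QV' Q' (App M' N))
| step_appr a QV Q M QV' Q' M' N :
    is_term 0 N ->
    step a (Preconf QV Q M) (Preconf QV' Q' M') ->
    step a (Preconf QV Q (App N M)) (Preconf QV' Q' (App N M'))
| step_lam a QV Q M QV' Q' M' p :
    is_pattern p ->
    step a (Preconf QV Q M) (Preconf QV' Q' M') ->
    step a (Preconf QV Q (lam p M)) (Preconf QV' Q' (lam p M')).

Definition red_label (a : label) (C C' : preconf R) : Prop :=
  wf_preconf C /\ step a C C'.

Definition red (C C' : preconf R) : Prop :=
  exists a, red_label a C C'.

End Reduction.

(* Main.v *)
Require Import Defs.
From Stdlib Require Import List Permutation.
From mathcomp Require Import all_boot all_order all_algebra.
From mathcomp Require Import finmap complex reals.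
From mathcomp Require Import zify.

(* Well-formedness is a counting condition. Give an occurrence of a variable
   weight [2 ^ d], where [d] is the number of bangs around it. Then [G |- M] is
   well formed iff every linear variable of [G] has weight 1 in [M], the quantum
   variables of [M] are exactly those of [G], each of weight 1, every other free
   variable of [M] is some [!x] of [G], and each variable bound by a linear
   pattern has weight 1 in its scope. Necessity is an induction on derivations;
   for sufficiency, shared variables are renamed apart in the components of an
   application or a tuple and contracted afterwards. A reduction step does not
   change any weight that is at most 1, except that [new] creates a quantum
   variable of weight 1, so the counting condition is preserved. *)

(** * Weights *)

(** The structural rules obstruct a direct induction: exchange, weakening, contraction and
    dereliction can end a derivation independently of the shape of the term, and contraction even
    rewrites the term, so a derivation cannot be inverted along its subject. Counting is directed by
    the syntax and replaces a substitution lemma by arithmetic. The function [weight] takes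
    arbitrary functions on names and indices, not a single variable: closing and substitution then
    act by changing these functions, in which the weight is additive. *)

Definition zero (_ : nat) : nat := 0.

Definition delta (i j : nat) : nat := j == i.

Definition off (xs : seq nat) (f : nat -> nat) (x : nat) : nat :=
  if x \in xs then 0 else f x.

Definition shift (k : nat) (f : nat -> nat) (i : nat) : nat :=
  if i < k then 0 else f (i - k).

(* Since an occurrence under a bang counts twice, a variable has weight 1 iff
   it occurs exactly once and outside every bang. *)
Fixpoint weight (fc fq fb : nat -> nat) (M : term) : nat :=
  match M with
  | BVar i => fb i
  | Var x => fc x
  | QVar r => fq r
  | Bit _ | Gate _ => 0
  | Bang M => (weight fc fq fb M).*2
  | New M => weight fc fq fb M
  | App M N => weight fc fq fb M + weight fc fq fb N
  | Tup Ms => sumn (map (weight fc fq fb) Ms)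
  | LamBang M => weight fc fq (shift 1 fb) M
  | Lam s M => weight fc fq (shift (arity s) fb) M
  end.

Notation cweight x := (weight (delta x) zero zero).
Notation qweight r := (weight zero (delta r) zero).
Notation bweight i := (weight zero zero (delta i)).

(** The test on tuples excludes [Tup [::]], which [tuple_term] returns on an empty list, for
    instance for a gate with [n i = 0]. *)
Fixpoint linear_binders (M : term) : bool :=
  match M with
  | BVar _ | Var _ | QVar _ | Bit _ | Gate _ => true
  | Bang M | New M | LamBang M => linear_binders M
  | App M N => linear_binders M && linear_binders N
  | Tup Ms => (1 < size Ms) && all linear_binders Ms
  | Lam s M => all (fun i => bweight i M == 1) (iota 0 (arity s)) &&
               linear_binders M
  end.

Fixpoint inst (f : nat -> term) (M : term) : term :=
  match M with
  | Var x => f x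
  | BVar _ | QVar _ | Bit _ | Gate _ => M
  | Bang M => Bang (inst f M)
  | New M => New (inst f M)
  | App M N => App (inst f M) (inst f N)
  | Tup Ms => Tup (map (inst f) Ms)
  | LamBang M => LamBang (inst f M)
  | Lam s M => Lam s (inst f M)
  end.

Notation rename f := (inst (fun x => Var (f x))).

(* Inverts [close], under the assumption that the dangling indices of [M] are
   less than [k + size zs]. *)
Fixpoint open (k : nat) (zs : seq nat) (M : term) : term :=
  match M with
  | BVar i => if k <= i then Var (nth 0 zs (i - k)) else M
  | Var _ | QVar _ | Bit _ | Gate _ => M
  | Bang M => Bang (open k zs M)
  | New M => New (open k zs M)
  | App M N => App (open k zs M) (open k zs N)
  | Tup Ms => Tup (map (open k zs) Ms)
  | LamBang M => LamBang (open k.+1 zs M)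
  | Lam s M => Lam s (open (k + arity s) zs M)
  end.

(** The measure for sufficiency: components get renamed and bodies opened, so they are no longer
    subterms, but both operations keep this size. *)
Fixpoint term_size (M : term) : nat :=
  match M with
  | Bang M | New M | LamBang M | Lam _ M => (term_size M).+1
  | App M N => (term_size M + term_size N).+1
  | Tup Ms => (sumn (map term_size Ms)).+1
  | _ => 1
  end.

Section TermInduction.
Variable P : term -> Prop.
Hypotheses (hBVar : forall i, P (BVar i)) (hVar : forall x, P (Var x))
  (hQVar : forall r, P (QVar r)) (hBang : forall M, P M -> P (Bang M))
  (hBit : forall b, P (Bit b)) (hGate : forall i, P (Gate i))
  (hNew : forall M, P M -> P (New M))
  (hApp : forall M N, P M -> P N -> P (App M N))
  (hTup : forall Ms, Forall P Ms -> P (Tup Ms))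
  (hLamBang : forall M, P M -> P (LamBang M))
  (hLam : forall s M, P M -> P (Lam s M)).

Fixpoint term_nested_ind (M : term) : P M :=
  match M with
  | BVar i => hBVar i
  | Var x => hVar x
  | QVar r => hQVar r
  | Bang M => hBang M (term_nested_ind M)
  | Bit b => hBit b
  | Gate i => hGate i
  | New M => hNew M (term_nested_ind M)
  | App M N => hApp M N (term_nested_ind M) (term_nested_ind N)
  | Tup Ms => hTup Ms
      ((fix F (Ms : seq term) : Forall P Ms :=
          match Ms with
          | [::] => Forall_nil P
          | M :: Ms => Forall_cons M (term_nested_ind M) (F Ms)
          end) Ms)
  | LamBang M => hLamBang M (term_nested_ind M)
  | Lam s M => hLam s M (term_nested_ind M)
  end.
End TermInduction.

(** * Weights as linear functions of the values on names and indices *)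

Lemma eq_shift k f g : f =1 g -> shift k f =1 shift k g.
Proof. by move=> fg i; rewrite /shift fg. Qed.

Lemma shift_zero k : shift k zero =1 zero.
Proof. by move=> i; rewrite /shift /zero if_same. Qed.

Lemma eq_weight fc fc' fq fq' fb fb' M :
  fc =1 fc' -> fq =1 fq' -> fb =1 fb' ->
  weight fc fq fb M = weight fc' fq' fb' M.
Proof.
move=> hc hq; elim/term_nested_ind: M fb fb' => //=.
- by move=> M IH fb fb' hb; rewrite (IH fb fb').
- by move=> M N IHM IHN fb fb' hb; rewrite (IHM fb fb') // (IHN fb fb').
- move=> Ms; elim=> //= M {}Ms hM _ IH fb fb' hb.
  by rewrite (IH fb fb') // (hM fb fb').
- by move=> M IH fb fb' hb; apply/IH/eq_shift.
- by move=> s M IH fb fb' hb; apply/IH/eq_shift.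
Qed.

Lemma weight_closed fc fq fb fb' k M :
  is_term k M -> (forall i, i < k -> fb i = fb' i) ->
  weight fc fq fb M = weight fc fq fb' M.
Proof.
elim/term_nested_ind: M k fb fb' => //=.
- by move=> i k fb fb' ik; apply.
- by move=> M IH k fb fb' hM hb; rewrite (IH _ _ _ hM hb).
- move=> M N IHM IHN k fb fb' /andP[hM hN] hb.
  by rewrite (IHM _ _ _ hM hb) (IHN _ _ _ hN hb).
- move=> Ms IH k fb fb' /andP[_]; elim: IH => //= M {}Ms hM _ IH.
  by case/andP=> kM kMs hb; rewrite (hM _ _ _ kM hb) IH.
- move=> M IH k fb fb' hM hb; apply: (IH _ _ _ hM) => i ik.
  by rewrite /shift; case: ifP => // i1; apply: hb; lia.
- move=> s M IH k fb fb' /andP[_ hM] hb; apply: (IH _ _ _ hM) => i ik.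
  by rewrite /shift; case: ifP => // i1; apply: hb; lia.
Qed.

Lemma weight_zero M : weight zero zero zero M = 0.
Proof.
elim/term_nested_ind: M => //=.
- by move=> M ->.
- by move=> M N -> ->.
- by move=> Ms; elim=> //= M {}Ms -> _ ->.
- by move=> M IH; rewrite -[RHS]IH; apply: eq_weight => //; apply: shift_zero.
- by move=> s M IH; rewrite -[RHS]IH; apply: eq_weight => //; apply: shift_zero.
Qed.

Lemma weight_add fc fc' fq fq' fb fb' M :
  weight (fun x => fc x + fc' x) (fun x => fq x + fq' x)
    (fun x => fb x + fb' x) M = weight fc fq fb M + weight fc' fq' fb' M.
Proof.
have sh k f f' : shift k (fun i => f i + f' i) =1
    (fun i => shift k f i + shift k f' i) by move=> i; rewrite /shift; case: ifP.
elim/term_nested_ind: M fb fb' => //=.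
- by move=> M IH fb fb'; rewrite IH doubleD.
- by move=> M N IHM IHN fb fb'; rewrite IHM IHN addnACA.
- by move=> Ms; elim=> //= M {}Ms hM _ IH fb fb'; rewrite hM IH addnACA.
- by move=> M IH fb fb'; rewrite -IH; apply: eq_weight.
- by move=> s M IH fb fb'; rewrite -IH; apply: eq_weight.
Qed.

Lemma weight_scale c fc fq fb M :
  weight (fun x => c * fc x) (fun x => c * fq x) (fun x => c * fb x) M =
  c * weight fc fq fb M.
Proof.
have sh k f : shift k (fun i => c * f i) =1 (fun i => c * shift k f i).
  by move=> i; rewrite /shift; case: ifP; rewrite ?muln0.
elim/term_nested_ind: M fb => //=.
- by move=> M IH fb; rewrite IH doubleMr.
- by move=> b fb; rewrite muln0.
- by move=> i fb; rewrite muln0.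
- by move=> M N IHM IHN fb; rewrite IHM IHN mulnDr.
- by move=> Ms; elim=> //= [|M {}Ms hM _ IH] fb; rewrite ?muln0 // hM IH mulnDr.
- by move=> M IH fb; rewrite -IH; apply: eq_weight.
- by move=> s M IH fb; rewrite -IH; apply: eq_weight.
Qed.

(** Linearity applied to a pointwise identity: [fc] is [off xs fc] plus the sum of [fc x * delta x]
    over the distinct [x] in [xs]. *)
Lemma weight_split fc fq fb xs M :
  uniq xs ->
  weight fc fq fb M =
  weight (off xs fc) fq fb M + \sum_(x <- xs) fc x * cweight x M.
Proof.
elim: xs => [|x xs IH] /=; first by rewrite big_nil addn0.
case/andP=> xxs /IH ->; rewrite big_cons addnA; congr (_ + _).
rewrite -weight_scale -weight_add; apply: eq_weight => y //=; last first.
- by rewrite /zero muln0 addn0.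
- by rewrite /zero muln0 addn0.
rewrite /off inE /delta; case: eqP => [->|_]; last by rewrite muln0 addn0.
by rewrite (negPf xxs) muln1.
Qed.

Lemma weight_close fc fq fb k xs M :
  weight fc fq fb (close k xs M) =
  weight (fun x => if x \in xs then fb (k + index x xs) else fc x) fq fb M.
Proof.
elim/term_nested_ind: M k fb => //=.
- by move=> x k fb; case: ifP.
- by move=> M IH k fb; rewrite IH.
- by move=> M N IHM IHN k fb; rewrite IHM IHN.
- move=> Ms IH k fb; rewrite -map_comp.
  by elim: IH => //= M {}Ms hM _ ->; rewrite hM.
- move=> M IH k fb; rewrite IH; apply: eq_weight => // x.
  by case: ifP => // _; rewrite /shift addSn subn1 /=.
- move=> s M IH k fb; rewrite IH; apply: eq_weight => // x.
  case: ifP => // _; rewrite /shift ifF; [congr fb|]; lia.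
Qed.

(** The inserted terms have no dangling index, so the values of [fb], shifted by the binders
    crossed, do not matter for them and [zero] can stand in. *)
Lemma weight_inst fc fq fb f M :
  (forall x, is_term 0 (f x)) ->
  weight fc fq fb (inst f M) =
  weight (fun x => weight fc fq zero (f x)) fq fb M.
Proof.
move=> hf; elim/term_nested_ind: M fb => //=.
- by move=> x fb; apply: weight_closed (hf x) _.
- by move=> M IH fb; rewrite IH.
- by move=> M N IHM IHN fb; rewrite IHM IHN.
- move=> Ms IH fb; rewrite -map_comp.
  by elim: IH => //= M {}Ms hM _ ->; rewrite hM.
Qed.

Lemma subst_inst xs Ns M :
  subst xs Ns M = inst (fun x => nth (Var x) Ns (index x xs)) M.
Proof.
elim/term_nested_ind: M => //=.
- by move=> M ->.
- by move=> M ->.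
- by move=> M N -> ->.
- by move=> Ms IH; congr Tup; elim: IH => //= M {}Ms -> _ ->.
- by move=> M ->.
- by move=> s M ->.
Qed.

(** * Terms and binders under instantiation, closing and opening *)

Lemma is_termW j k M : j <= k -> is_term j M -> is_term k M.
Proof.
elim/term_nested_ind: M j k => //=.
- by move=> i j k; lia.
- by move=> M N IHM IHN j k jk /andP[hM hN]; rewrite (IHM j) // (IHN j).
- move=> Ms IH j k jk /andP[-> hMs] /=; elim: IH hMs => //= M {}Ms hM _ IH.
  by case/andP=> jM jMs; rewrite (hM j) // IH.
- by move=> M IH j k jk; apply: IH.
- move=> s M IH j k jk /andP[-> hM] /=; apply: IH hM; lia.
Qed.

Lemma is_term_inst k f M :
  (forall x, is_term 0 (f x)) -> is_term k M -> is_term k (inst f M).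
Proof.
move=> hf; elim/term_nested_ind: M k => //=.
- by move=> x k _; apply: is_termW (hf x).
- by move=> M N IHM IHN k /andP[hM hN]; rewrite IHM ?IHN.
- move=> Ms IH k; rewrite size_map => /andP[-> hMs] /=.
  elim: IH hMs => //= M {}Ms hM _ IH /andP[kM kMs].
  by rewrite hM // IH.
- by move=> M IH k; apply: IH.
- by move=> s M IH k /andP[-> hM]; apply: IH.
Qed.

Lemma is_term_close k xs M :
  is_term k M -> is_term (k + size xs) (close k xs M).
Proof.
elim/term_nested_ind: M k => //=.
- by move=> i k; lia.
- by move=> x k _; case: ifP => //=; rewrite ltn_add2l index_mem.
- by move=> M N IHM IHN k /andP[hM hN]; rewrite IHM ?IHN.
- move=> Ms IH k; rewrite size_map => /andP[-> hMs] /=.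
  elim: IH hMs => //= M {}Ms hM _ IH /andP[kM kMs].
  by rewrite hM // IH.
- by move=> M IH k; apply: IH.
- by move=> s M IH k /andP[-> hM]; rewrite addnAC; apply: IH.
Qed.

Lemma linear_binders_inst f M :
  (forall x, is_term 0 (f x)) -> (forall x, linear_binders (f x)) ->
  linear_binders M -> linear_binders (inst f M).
Proof.
move=> hf lf; elim/term_nested_ind: M => //=.
- by move=> M N IHM IHN /andP[hM hN]; rewrite IHM ?IHN.
- move=> Ms IH; rewrite size_map => /andP[-> hMs] /=.
  elim: IH hMs => //= M {}Ms hM _ IH /andP[kM kMs].
  by rewrite hM // IH.
(* The inserted terms add nothing to the weight of an index bound here. *)
- move=> s M IH /andP[/allP lM /IH ->]; rewrite andbT.
  apply/allP=> i /lM /eqP <-; rewrite weight_inst //; apply/eqP/eq_weight => // x.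
  exact: weight_zero.
Qed.

Lemma linear_binders_close k xs M :
  linear_binders (close k xs M) = linear_binders M.
Proof.
elim/term_nested_ind: M k => //=.
- by move=> x k; case: ifP.
- by move=> M N IHM IHN k; rewrite IHM IHN.
- move=> Ms IH k; rewrite size_map; congr (_ && _).
  by elim: IH => //= M {}Ms -> _ ->.
(* Below this binder the closed names become indices at least [arity s], beyond the ones that it
   binds. *)
- move=> s M IH k; rewrite IH; congr (_ && _); apply: eq_in_all => i.
  rewrite mem_iota => hi; rewrite weight_close; congr (_ == _).
  apply: eq_weight => // x; case: ifP => // _; rewrite /delta /zero; lia.
Qed.

Lemma weight_notin_fv x M : x \notin fv M -> cweight x M = 0.
Proof.
elim/term_nested_ind: M => //=.
- by move=> y; rewrite inE /delta => /negPf; rewrite eq_sym => ->.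
- by move=> M IH hx; rewrite IH.
- by move=> M N IHM IHN; rewrite mem_cat => /norP[/IHM -> /IHN ->].
- move=> Ms; elim=> //= M {}Ms hM _ IH.
  by rewrite mem_cat => /norP[/hM -> /IH ->].
- move=> M IH hx; rewrite -[RHS](IH hx); apply: eq_weight => //; exact: shift_zero.
- move=> s M IH hx; rewrite -[RHS](IH hx); apply: eq_weight => //; exact: shift_zero.
Qed.

Lemma weight_fv x M : cweight x M = 0 -> x \notin fv M.
Proof.
have wsh k N : weight (delta x) zero (shift k zero) N = cweight x N.
  by apply: eq_weight => //; exact: shift_zero.
elim/term_nested_ind: M => //=.
- by move=> y; rewrite /delta inE eq_sym; case: eqP.
- by move=> M IH hx; apply: IH; lia.
- by move=> M N IHM IHN hx; rewrite mem_cat negb_or IHM ?IHN //; lia.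
- move=> Ms; elim=> //= M {}Ms hM _ IH hx.
  by rewrite mem_cat negb_or hM ?IH //; lia.
- by move=> M IH; rewrite wsh.
- by move=> s M IH; rewrite wsh.
Qed.

Lemma weight_notin_qv r M : r \notin qv M -> qweight r M = 0.
Proof.
elim/term_nested_ind: M => //=.
- by move=> y; rewrite inE /delta => /negPf; rewrite eq_sym => ->.
- by move=> M IH hx; rewrite IH.
- by move=> M N IHM IHN; rewrite mem_cat => /norP[/IHM -> /IHN ->].
- move=> Ms; elim=> //= M {}Ms hM _ IH.
  by rewrite mem_cat => /norP[/hM -> /IH ->].
- move=> M IH hx; rewrite -[RHS](IH hx); apply: eq_weight => //; exact: shift_zero.
- move=> s M IH hx; rewrite -[RHS](IH hx); apply: eq_weight => //; exact: shift_zero.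
Qed.

(** Freshness of [zs] keeps closing from capturing free occurrences of these names; distinctness
    lets [index] recover the position. *)
Lemma close_open k zs M :
  uniq zs -> is_term (k + size zs) M -> ~~ has (mem (fv M)) zs ->
  close k zs (open k zs M) = M.
Proof.
move=> uz; elim/term_nested_ind: M k => //=.
- move=> i k hi _; case: leqP => ki //=.
  have h : i - k < size zs by rewrite ltn_subLR.
  by rewrite mem_nth // index_uniq // subnKC.
- move=> x k _ /hasPn h; case: ifP => // /h /=; by rewrite inE eqxx.
- by move=> M IH k hM h; rewrite IH.
- by move=> M IH k hM h; rewrite IH.
- move=> M N IHM IHN k /andP[hM hN] /hasPn h.
  by rewrite IHM ?IHN //; apply/hasPn => x /h /=; rewrite mem_cat => /norP[].
- move=> Ms IH k /andP[_ hMs] h; congr Tup.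
  elim: IH hMs h => //= M {}Ms hM _ IH /andP[kM kMs] /hasPn h.
  rewrite hM ?IH //; apply/hasPn => x /h /=; by rewrite mem_cat => /norP[].
- by move=> M IH k hM h; rewrite IH.
- by move=> s M IH k /andP[_ hM] h; rewrite IH // addnAC.
Qed.

Lemma is_term_open k zs M :
  is_term (k + size zs) M -> is_term k (open k zs M).
Proof.
elim/term_nested_ind: M k => //=.
- by move=> i k hi; case: (leqP k i).
- by move=> M N IHM IHN k /andP[hM hN]; rewrite IHM ?IHN.
- move=> Ms IH k; rewrite size_map => /andP[-> hMs] /=.
  elim: IH hMs => //= M {}Ms hM _ IH /andP[kM kMs].
  by rewrite hM // IH.
- by move=> M IH k; rewrite -addSn; apply: IH.
- by move=> s M IH k /andP[-> hM]; apply: IH; rewrite addnAC.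
Qed.

Lemma term_size_open k zs M : term_size (open k zs M) = term_size M.
Proof.
elim/term_nested_ind: M k => //=.
- by move=> i k; case: ifP.
- by move=> M IH k; rewrite IH.
- by move=> M IH k; rewrite IH.
- by move=> M N IHM IHN k; rewrite IHM IHN.
- move=> Ms IH k; congr S; rewrite -map_comp.
  by elim: IH => //= M {}Ms -> _ [->].
- by move=> M IH k; rewrite IH.
- by move=> s M IH k; rewrite IH.
Qed.

Lemma term_size_rename f M : term_size (rename f M) = term_size M.
Proof.
elim/term_nested_ind: M => //=.
- by move=> M ->.
- by move=> M ->.
- by move=> M N -> ->.
- move=> Ms IH; congr S; rewrite -map_comp.
  by elim: IH => //= M {}Ms -> _ [->].
- by move=> M ->.
- by move=> s M ->.
Qed.

Lemma inst_inst f g M : inst f (inst g M) = inst (fun x => inst f (g x)) M.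
Proof.
elim/term_nested_ind: M => //=.
- by move=> M ->.
- by move=> M ->.
- by move=> M N -> ->.
- by move=> Ms IH; congr Tup; elim: IH => //= M {}Ms -> _ ->.
- by move=> M ->.
- by move=> s M ->.
Qed.

Lemma eq_inst f g M : {in fv M, f =1 g} -> inst f M = inst g M.
Proof.
elim/term_nested_ind: M => //=.
- by move=> x; apply; rewrite inE.
- by move=> M IH h; rewrite IH.
- by move=> M IH h; rewrite IH.
- by move=> M N IHM IHN h; rewrite IHM ?IHN // => x hx; apply: h;
     rewrite mem_cat hx ?orbT.
- move=> Ms IH h; congr Tup; elim: IH h => //= M {}Ms hM _ IH h.
  by rewrite hM ?IH // => x hx; apply: h; rewrite mem_cat hx ?orbT.
- by move=> M IH h; rewrite IH.
- by move=> s M IH h; rewrite IH.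
Qed.

Lemma inst_Var M : inst Var M = M.
Proof.
elim/term_nested_ind: M => //=.
- by move=> M ->.
- by move=> M ->.
- by move=> M N -> ->.
- by move=> Ms IH; congr Tup; elim: IH => //= M {}Ms -> _ ->.
- by move=> M ->.
- by move=> s M ->.
Qed.

(** * Weights under reduction *)

Lemma arity_shape_of p : arity (shape_of p) = size (pvars p).
Proof. by case: p. Qed.

(** [shift] gives weight 0 to the indices just bound, so binding a pattern amounts to switching its
    names off. *)
Lemma weight_lam fc fq p M :
  weight fc fq zero (lam p M) = weight (off (pvars p) fc) fq zero M.
Proof.
rewrite /lam /= weight_close; apply: eq_weight => // [x|]; last exact: shift_zero.
by rewrite /off; case: ifP => // _; rewrite shift_zero.
Qed.

Lemma weight_lam_bang fc fq x M :
  weight fc fq zero (lam_bang x M) = weight (off [:: x] fc) fq zero M.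
Proof. exact: (weight_lam fc fq (PVar x) M). Qed.

Lemma bweight_close xs i M :
  uniq xs -> is_term 0 M -> i < size xs ->
  bweight i (close 0 xs M) = cweight (nth 0 xs i) M.
Proof.
move=> uxs tM ixs; rewrite weight_close (weight_closed _ _ _ zero _ _ tM) //.
apply: eq_weight => // x; rewrite /delta add0n /zero.
case: ifP => [xxs|/negbT xxs]; last first.
  by case: eqP => // xE; rewrite xE mem_nth in xxs.
by rewrite -{2}(nth_index 0 xxs) nth_uniq // index_mem.
Qed.

(** As the names of the pattern are distinct, index [i] of the closed body stands for the [i]-th
    name only; this gives the condition in the named form that the rules use. *)
Lemma linear_binders_lam p M :
  uniq (pvars p) -> is_term 0 M ->
  linear_binders (lam p M) =
  all (fun x => cweight x M == 1) (pvars p) && linear_binders M.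
Proof.
move=> up tM; rewrite /= linear_binders_close arity_shape_of; congr (_ && _).
rewrite -[in RHS](mkseq_nth 0 (pvars p)) all_map; apply: eq_in_all => i.
by rewrite mem_iota /= => hi; rewrite bweight_close.
Qed.

Lemma is_term_lam {p M} : is_pattern p -> is_term 0 M -> is_term 0 (lam p M).
Proof.
case/andP=> p0 _ tM; rewrite /= arity_shape_of is_term_close // andbT.
by case: (pvars p) p0.
Qed.

Lemma is_term_lam_bang x M : is_term 0 M -> is_term 0 (lam_bang x M).
Proof. exact: (@is_term_close 0 [:: x]). Qed.

Lemma is_term_nth xs Ns (x : nat) :
  all (is_term 0) Ns -> is_term 0 (nth (Var x) Ns (index x xs)).
Proof.
move=> tNs; case: (ltnP (index x xs) (size Ns)) => h.
  by move/(all_nthP (Var x)): tNs; apply.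
by rewrite nth_default.
Qed.

Lemma linear_binders_nth xs Ns (x : nat) :
  all linear_binders Ns -> linear_binders (nth (Var x) Ns (index x xs)).
Proof.
move=> tNs; case: (ltnP (index x xs) (size Ns)) => h.
  by move/(all_nthP (Var x)): tNs; apply.
by rewrite nth_default.
Qed.

Lemma is_term_subst xs Ns M :
  all (is_term 0) Ns -> is_term 0 M -> is_term 0 (subst xs Ns M).
Proof.
move=> tNs tM; rewrite subst_inst; apply: is_term_inst => // x.
exact: is_term_nth.
Qed.

Lemma linear_binders_subst xs Ns M :
  all (is_term 0) Ns -> all linear_binders Ns -> linear_binders M ->
  linear_binders (subst xs Ns M).
Proof.
move=> tNs lNs lM; rewrite subst_inst; apply: linear_binders_inst => // x.
  exact: is_term_nth.
exact: linear_binders_nth.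
Qed.

(** Once the weight is split along [xs], each occurrence of the [i]-th name contributes the weight
    of the [i]-th term, scaled by the bangs around it. *)
Lemma weight_subst fc fq xs Ns M :
  uniq xs -> size Ns = size xs -> all (is_term 0) Ns ->
  weight fc fq zero (subst xs Ns M) =
  weight (off xs fc) fq zero M +
  \sum_(i < size xs)
     weight fc fq zero (nth (Var 0) Ns i) * cweight (nth 0 xs i) M.
Proof.
move=> uxs sz tNs; rewrite subst_inst weight_inst => [|x]; last exact: is_term_nth.
rewrite (weight_split _ _ _ xs) //; congr (_ + _).
  apply: eq_weight => // x; rewrite /off; case: ifPn => // xxs.
  (* A name outside [xs] has index [size xs], past the end of [Ns], so [nth] returns the name
     itself. *)
  by rewrite nth_default // sz leqNgt index_mem.
rewrite (big_nth 0) big_mkord; apply: eq_bigr => i _.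
by rewrite index_uniq // (set_nth_default (Var 0)) ?sz.
Qed.

Lemma weight_tuple_term fc fq fb Ms :
  weight fc fq fb (tuple_term Ms) = sumn (map (weight fc fq fb) Ms).
Proof. by case: Ms => // M [|N Ms] //=; rewrite addn0. Qed.

Lemma is_term_tuple_term k Ms :
  0 < size Ms -> all (is_term k) Ms -> is_term k (tuple_term Ms).
Proof. by case: Ms => // M [|N Ms] //= _ /andP[]. Qed.

Lemma linear_binders_tuple_term Ms :
  linear_binders (tuple_term Ms) -> (0 < size Ms) && all linear_binders Ms.
Proof. by case: Ms => [|M [|N Ms]] //= ->. Qed.

Section Step.
Local Open Scope fset_scope.
Variables (R : realType) (n : nat -> nat) (U : forall i, 'M[R[i]%C]_(2 ^ n i)).

Let created (C C' : preconf R) (fq : nat -> nat) : nat :=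
  \sum_(r <- enum_fset (pc_vars C' `\` pc_vars C)) fq r.

Let created0 (QV : {fset nat}) Q Q' M M' fq :
  created (@Preconf R QV Q M) (@Preconf R QV Q' M') fq = 0%N.
Proof. by rewrite /created /= fsetDv big_nil. Qed.

(* The bound 1 on the weight excludes the variables that a [Cbeta] step
   duplicates or erases: they occur in a bang, hence have weight at least 2. *)
Lemma step_weight a C C' :
  step U a C C' -> linear_binders (pc_term C) ->
  [/\ is_term 0 (pc_term C), is_term 0 (pc_term C'),
      linear_binders (pc_term C') &
      forall fc fq, (weight fc fq zero (pc_term C) <= 1)%N ->
        weight fc fq zero (pc_term C') =
        (weight fc fq zero (pc_term C) + created C C' fq)%N].
Proof.
elim=> {a C C'}; rewrite /pc_term.
- move=> i QV Q rs urs; rewrite /= => h.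
  case/andP: (linear_binders_tuple_term _ h) => sz _.
  have t : is_term 0 (tuple_term [seq QVar (val r) | r <- rs]).
    by apply: is_term_tuple_term => //; rewrite all_map; apply/allP.
  by split=> // fc fq _; rewrite created0 addn0.
- move=> QV Q c r rQV _; split=> // fc fq _ /=.
  rewrite /created /= fsetDUl fsetDv fset0U.
  have -> : [fset r] `\` QV = [fset r].
    by apply/fsetDidPl; rewrite fdisjoint1X.
  by rewrite big_seq_fset1.
- move=> QV Q x M N tM tN; rewrite [linear_binders _]/= => /andP[lM lN].
  move: lM; rewrite [_ && _](linear_binders_lam (PVar x)) //= andbT.
  move=> /andP[/eqP xM lM].
  split; rewrite ?tN ?andbT.
  + exact: (@is_term_lam (PVar x)).
  + by apply: is_term_subst => //=; rewrite tN.
  + by apply: linear_binders_subst => //=; rewrite ?tN ?lN.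
  + move=> fc fq _; rewrite created0 addn0 weight_subst //= ?tN //.
    by rewrite big_ord1 /= xM muln1 -(weight_lam fc fq (PVar x)).
- move=> QV Q xs rs M pxs sz tM; rewrite [linear_binders _]/= => /andP[lM lN].
  case/andP: (pxs) => /= xs0 uxs.
  move: lM; rewrite [_ && _](linear_binders_lam (PTup xs)) //= => /andP[/allP xM lM].
  have tN : all (is_term 0) (map QVar rs) by rewrite all_map; apply/allP.
  have lN' : all linear_binders (map QVar rs) by rewrite all_map; apply/allP.
  split.
  + apply/andP; split; first exact: (@is_term_lam (PTup xs)).
    by apply: is_term_tuple_term => //; rewrite size_map sz lt0n size_eq0.
  + exact: is_term_subst.
  + exact: linear_binders_subst.
  + move=> fc fq _; rewrite created0 addn0 weight_subst ?size_map //.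
    rewrite [RHS]/=; have /= -> := weight_lam fc fq (PTup xs) M; congr addn.
    rewrite weight_tuple_term -map_comp sumnE big_map (big_nth 0%N) big_mkord sz.
    apply: eq_bigr => i _; rewrite (eqP (xM _ (mem_nth _ _))) // muln1.
    by rewrite (nth_map 0%N) // sz.
- move=> QV Q x M N tM tN; rewrite /= linear_binders_close => /andP[lM lN].
  split.
  + by rewrite tN andbT; apply: (is_term_lam_bang x).
  + by apply: is_term_subst => //=; rewrite tN.
  + by apply: linear_binders_subst => //=; rewrite ?tN ?lN.
  + move=> fc fq; rewrite created0 addn0 weight_subst //= ?tN //.
    rewrite big_ord1 /=; have /= -> := weight_lam_bang fc fq x M.
    (* A redex of weight at most 1 forces [N], doubled by its bang, to have weight 0, whatever the
       number of its copies. *)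
    case: (weight fc fq zero N) => [|k]; lia.
- move=> QV Q p L M N pp hL tL tM tN.
  rewrite [linear_binders _]/= => /and3P[lL lM lN].
  case/andP: (pp) => _ up; move: (lM : linear_binders (lam p M)).
  rewrite linear_binders_lam // => /andP[/allP pM {}lM].
  have tLM : is_term 0 (App L M) by rewrite /= tL tM.
  have pL x : x \in pvars p -> cweight x L = 0%N.
    by move=> xp; apply: weight_notin_fv; apply: (hasPn hL).
  have tpM := is_term_lam pp tM; have tpLM := is_term_lam pp tLM.
  split.
  + by apply/and3P.
  + by apply/andP.
  + suff: linear_binders (lam p (App L M)) by move=> lpLM; apply/andP.
    rewrite linear_binders_lam //= lL lM !andbT.
    by apply/allP=> x xp; rewrite pL // ?addn0 pM.
  + move=> fc fq _; rewrite created0 addn0.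
    rewrite -[LHS]/(weight fc fq zero (lam p (App L M)) + weight fc fq zero N)%N.
    rewrite -[RHS]/(weight fc fq zero L +
      (weight fc fq zero (lam p M) + weight fc fq zero N))%N.
    (* No name of [p] is free in [L], so switching these names off leaves the weight of [L]
       unchanged. *)
    rewrite !weight_lam /= (weight_split fc fq zero (pvars p) L up).
    rewrite big_seq big1 => [|x xp]; [by rewrite addn0 addnA|by rewrite pL ?muln0].
- move=> QV Q p L M N pp hL tL tM tN.
  rewrite [linear_binders _]/= => /andP[/andP[lM lN] lL].
  case/andP: (pp) => _ up; move: (lM : linear_binders (lam p M)).
  rewrite linear_binders_lam // => /andP[/allP pM {}lM].
  have tLM : is_term 0 (App M L) by rewrite /= tL tM.
  have pL x : x \in pvars p -> cweight x L = 0%N.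
    by move=> xp; apply: weight_notin_fv; apply: (hasPn hL).
  have tpM := is_term_lam pp tM; have tpLM := is_term_lam pp tLM.
  split.
  + by apply/andP; split=> //; apply/andP.
  + by apply/andP.
  + suff: linear_binders (lam p (App M L)) by move=> lpLM; apply/andP.
    rewrite linear_binders_lam //= lL lM !andbT.
    by apply/allP=> x xp; rewrite pL // ?addn0 pM.
  + move=> fc fq _; rewrite created0 addn0.
    rewrite -[LHS]/(weight fc fq zero (lam p (App M L)) + weight fc fq zero N)%N.
    rewrite -[RHS]/(weight fc fq zero (lam p M) + weight fc fq zero N +
      weight fc fq zero L)%N.
    rewrite !weight_lam /= (weight_split fc fq zero (pvars p) L up).
    rewrite big_seq big1 => [|x xp]; [by rewrite addn0 addnAC|by rewrite pL ?muln0].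
- move=> a QV Q M QV' Q' M' Ms Ns tT _ IH lT.
  have /andP[sz] : is_term 0 (Tup (Ms ++ M :: Ns)) := tT.
  have /andP[_] : linear_binders (Tup (Ms ++ M :: Ns)) := lT.
  rewrite !all_cat /= => /and3P[lMs lM lNs] /and3P[tMs _ tNs].
  have [_ tM' lM' wM'] := IH lM.
  have sz' : 1 < size (Ms ++ M' :: Ns) by move: sz; rewrite !size_cat.
  split=> //.
  + by apply/andP; split=> //; rewrite all_cat /=; apply/and3P.
  + by apply/andP; split=> //; rewrite all_cat /=; apply/and3P.
  + move=> fc fq; rewrite /= !map_cat !sumn_cat /= => le1.
    rewrite wM' /created /=; first by rewrite addnAC addnA.
    by apply: leq_trans le1; apply: leq_trans (leq_addr _ _) (leq_addl _ _).
- move=> a QV Q M QV' Q' M' N tN _ IH /andP[lM lN].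
  have [tM tM' lM' wM'] := IH lM.
  split; rewrite /= ?tM ?tM' ?lM' //.
  move=> fc fq le1; rewrite wM' /created /=; lia.
- move=> a QV Q M QV' Q' M' N tN _ IH /andP[lN lM].
  have [tM tM' lM' wM'] := IH lM.
  split; rewrite /= ?lM' ?andbT // ?tN // => fc fq le1; rewrite wM' /created /=; lia.
- move=> a QV Q M QV' Q' M' p pp _ IH lpM.
  have lM : linear_binders M.
    by rewrite -(linear_binders_close 0 (pvars p) M); case/andP: lpM.
  have [tM tM' lM' wM'] := IH lM.
  case/andP: (pp) => _ up.
  move: (lpM : linear_binders (lam p M)); rewrite linear_binders_lam //.
  move=> /andP[/allP pM _].
  split; try exact: is_term_lam.
  + suff: linear_binders (lam p M') by [].
    rewrite linear_binders_lam // lM' andbT; apply/allP=> x /pM /eqP xM.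
    (* A bound name has weight 1, within the bound of the induction hypothesis, and [zero] on
       quantum variables cancels the created ones. *)
    by rewrite wM' ?xM // /created /= big1.
  + move=> fc fq le1; have wl := weight_lam fc fq p.
    (* The hypothesis is used for [off (pvars p) fc], which is why it quantifies over all weight
       functions. *)
    have le1' : (weight (off (pvars p) fc) fq zero M <= 1)%N by rewrite -wl.
    by apply: etrans (wl M') _; rewrite (wM' _ _ le1') -wl.
Qed.
End Step.

(** * Well-formed judgements satisfy the counting condition *)

Definition item_lvars (e : env_item) : seq nat :=
  if e is EPat p then pvars p else [::].

Definition cvars (G : env) : seq nat := flatten (map item_cvars G).
Definition lvars (G : env) : seq nat := flatten (map item_lvars G).
Definition qvars (G : env) : seq nat := flatten (map item_qvars G).

(** Both directions rely on this: [is_term] demands a positive arity of a binder, and [wf_pat] a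
    non-empty list. *)
Definition nonempty_patterns (G : env) : bool :=
  all (fun e => if e is EPat p then pvars p != [::] else true) G.

(** A shared variable [!x] may have any weight. Weight functions take the place of a term because
    the components of a tuple are handled as a list, with their weights summed. *)
Definition balanced (G : env) (wc wq : nat -> nat) : Prop :=
  [/\ is_env G && nonempty_patterns G,
      forall x, x \in lvars G -> wc x = 1,
      forall x, x \notin cvars G -> wc x = 0 &
      forall r, wq r = (r \in qvars G)].

Definition typed (G : env) (M : term) : Prop :=
  [/\ balanced G (fun x => cweight x M) (fun r => qweight r M),
      is_term 0 M & linear_binders M].

Lemma cvars_cat G H : cvars (G ++ H) = cvars G ++ cvars H.
Proof. by rewrite /cvars map_cat flatten_cat. Qed.

Lemma lvars_cat G H : lvars (G ++ H) = lvars G ++ lvars H.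
Proof. by rewrite /lvars map_cat flatten_cat. Qed.

Lemma qvars_cat G H : qvars (G ++ H) = qvars G ++ qvars H.
Proof. by rewrite /qvars map_cat flatten_cat. Qed.

Lemma lvars_sub_cvars G : {subset lvars G <= cvars G}.
Proof.
elim: G => // e G IH x; rewrite /lvars /cvars /= !mem_cat => /orP[|/IH ->].
  by case: e => //= p ->.
by rewrite orbT.
Qed.

Lemma cvars_lin xs : cvars (map lin xs) = xs.
Proof. by elim: xs => //= x xs IH; rewrite /cvars /= -/(cvars _) IH. Qed.

Lemma lvars_lin xs : lvars (map lin xs) = xs.
Proof. by elim: xs => //= x xs IH; rewrite /lvars /= -/(lvars _) IH. Qed.

Lemma qvars_lin xs : qvars (map lin xs) = [::].
Proof. by elim: xs. Qed.

Lemma cvars_bang xs : cvars (map EBang xs) = xs.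
Proof. by elim: xs => //= x xs IH; rewrite /cvars /= -/(cvars _) IH. Qed.

Lemma lvars_bang xs : lvars (map EBang xs) = [::].
Proof. by elim: xs. Qed.

Lemma qvars_bang xs : qvars (map EBang xs) = [::].
Proof. by elim: xs. Qed.

Lemma cvars_q rs : cvars (map EQ rs) = [::].
Proof. by elim: rs. Qed.

Lemma lvars_q rs : lvars (map EQ rs) = [::].
Proof. by elim: rs. Qed.

Lemma qvars_q rs : qvars (map EQ rs) = rs.
Proof. by elim: rs => //= x xs IH; rewrite /qvars /= -/(qvars _) IH. Qed.

Lemma nonempty_patterns_lin xs : nonempty_patterns (map lin xs).
Proof. by elim: xs. Qed.

Lemma nonempty_patterns_bang xs : nonempty_patterns (map EBang xs).
Proof. by elim: xs. Qed.

Lemma nonempty_patterns_q rs : nonempty_patterns (map EQ rs).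
Proof. by elim: rs. Qed.

Lemma Permutation_flatten_map (f : env_item -> seq nat) G G' :
  Permutation G G' -> perm_eq (flatten (map f G)) (flatten (map f G')).
Proof.
elim=> //= [x l l' _ IH|x y l|l l' l'' _ h _]; last exact: perm_trans.
  by rewrite perm_cat2l.
by rewrite perm_catCA.
Qed.

Lemma Permutation_all (T : Type) (a : pred T) s s' :
  Permutation s s' -> all a s = all a s'.
Proof.
by elim=> //= [x l l' _ ->|x y l|l l' l'' _ -> _ ->] //; rewrite andbCA.
Qed.

Lemma is_env_Permutation G G' : Permutation G G' -> is_env G = is_env G'.
Proof.
move=> GG'; rewrite /is_env.
by rewrite !(perm_uniq (Permutation_flatten_map _ _ _ GG')).
Qed.

Lemma eq_balanced G wc wc' wq wq' :
  wc =1 wc' -> wq =1 wq' -> balanced G wc wq -> balanced G wc' wq'.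
Proof.
move=> hc hq [eG lG cG qG]; split=> // x; rewrite -?hc -?hq; auto.
Qed.

(** One monotonicity principle for exchange, weakening, dereliction and tuple patterns: these rules
    keep the term, hence its weights, and only drop linearity demands or allow more names. *)
Lemma balanced_sub G G' wc wq :
  is_env G' -> nonempty_patterns G' ->
  {subset lvars G' <= lvars G} -> {subset cvars G <= cvars G'} ->
  qvars G =i qvars G' -> balanced G wc wq -> balanced G' wc wq.
Proof.
move=> eG' pG' sl sc sq [_ lG cG qG]; split.
- by rewrite eG'.
- by move=> x /sl /lG.
- by move=> x xG'; apply: cG; apply: contra xG' => /sc.
- by move=> r; rewrite qG sq.
Qed.

Lemma is_env_cat G1 G2 :
  is_env (G1 ++ G2) ->
  [/\ is_env G1, is_env G2, forall x, x \in cvars G1 -> x \notin cvars G2 &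
      forall r, r \in qvars G1 -> r \notin qvars G2].
Proof.
rewrite /is_env -/(cvars (G1 ++ G2)) -/(qvars (G1 ++ G2)) cvars_cat qvars_cat.
rewrite !cat_uniq => /andP[/and3P[uc1 dc uc2] /and3P[uq1 dq uq2]]; split.
- by apply/andP.
- by apply/andP.
- by move=> x x1; apply: contra dc => x2; apply/hasP; exists x.
- by move=> x x1; apply: contra dq => x2; apply/hasP; exists x.
Qed.

(** The two environments have disjoint names, so a linear variable of one has weight 0 on the other
    side. *)
Lemma balanced_cat G1 G2 wc1 wc2 wq1 wq2 :
  is_env (G1 ++ G2) -> balanced G1 wc1 wq1 -> balanced G2 wc2 wq2 ->
  balanced (G1 ++ G2) (fun x => wc1 x + wc2 x) (fun r => wq1 r + wq2 r).
Proof.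
move=> eG [/andP[_ p1] l1 c1 q1] [/andP[_ p2] l2 c2 q2].
have [_ _ dc dq] := is_env_cat _ _ eG; split.
- by rewrite eG /nonempty_patterns all_cat; apply/and3P.
- move=> x; rewrite lvars_cat mem_cat => /orP[] xG.
    by rewrite l1 // c2 // dc // lvars_sub_cvars.
  rewrite l2 // c1 //; apply: contraL (lvars_sub_cvars _ _ xG); exact: dc.
- by move=> x; rewrite cvars_cat mem_cat => /norP[x1 x2]; rewrite c1 ?c2.
- move=> r; rewrite q1 q2 qvars_cat mem_cat.
  by case: (boolP (r \in qvars G1)) => [/dq /negPf ->|].
Qed.

Lemma typed_sub G G' M :
  is_env G' -> nonempty_patterns G' ->
  {subset lvars G' <= lvars G} -> {subset cvars G <= cvars G'} ->
  qvars G =i qvars G' -> typed G M -> typed G' M.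
Proof.
by move=> eG' pG' sl sc sq [bG tM lM]; split=> //; apply: balanced_sub bG.
Qed.

Lemma typed_exchange G G' M : Permutation G G' -> typed G M -> typed G' M.
Proof.
move=> GG' tG; have [[/andP[eG pG] _ _ _] _ _] := tG.
apply: typed_sub tG.
- by rewrite -(is_env_Permutation _ _ GG').
- by rewrite /nonempty_patterns -(Permutation_all _ _ _ _ GG').
- by move=> x; rewrite (perm_mem (Permutation_flatten_map _ _ _ GG')).
- by move=> x; rewrite -(perm_mem (Permutation_flatten_map _ _ _ GG')).
- by move=> x; apply: (perm_mem (Permutation_flatten_map _ _ _ GG')).
Qed.

(** Occurrences of [x] and [y] become [z], which may be one of the two. The names of [G] differ from
    all three, so their weights do not move, and the shared [z] may have any weight. *)
Lemma typed_contr G x y z M :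
  is_env (EBang z :: G) -> typed (EBang x :: EBang y :: G) M ->
  typed (EBang z :: G) (subst [:: x; y] [:: Var z; Var z] M).
Proof.
move=> eG [[/andP[eG' pG] lG cG qG] tM lM].
have [_ _ dx _] := is_env_cat [:: EBang x; EBang y] G eG'.
have [_ _ dz _] := is_env_cat [:: EBang z] G eG.
have cE v : cweight v (subst [:: x; y] [:: Var z; Var z] M) =
    weight (fun u => delta v (if u \in [:: x; y] then z else u)) zero zero M.
  rewrite subst_inst weight_inst => [|u]; last exact: is_term_nth.
  apply: eq_weight => // u; rewrite !inE /= ![_ == u]eq_sym.
  by case: eqP => //= _; case: eqP.
split; last 2 first.
- exact: is_term_subst.
- exact: linear_binders_subst.
split.
- by rewrite eG.
- move=> v vG; have vc : v \in cvars G := lvars_sub_cvars G v vG.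
  rewrite cE -(lG v vG).
  apply: eq_weight => // u; rewrite /delta; case: ifP => // uxy.
  have -> : (z == v) = false.
    by apply/eqP => zv; move: (dz z); rewrite inE eqxx zv vc => /(_ isT).
  by apply/esym/eqP; rewrite eqb0; apply/eqP => uv; move: (dx u); rewrite uv vc -uv; move/(_ uxy).
- move=> v; rewrite inE negb_or => /andP[vz vG]; rewrite cE.
  (* If [v] is [x] or [y], it has been renamed away, as it is not [z]; otherwise it was already
     absent from [M]. *)
  case: (boolP (v \in [:: x; y])) => vxy.
    rewrite -[RHS](weight_zero M); apply: eq_weight => // u; rewrite /delta /zero.
    case: ifPn => [_|uxy]; first by rewrite eq_sym (negPf vz).
    by case: eqP => // uv; rewrite uv vxy in uxy.
  rewrite -[RHS](cG v).
    apply: eq_weight => // u; rewrite /delta.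
    case: ifPn => // uxy; rewrite eq_sym (negPf vz).
    by case: eqP => // uv; rewrite -uv uxy in vxy.
  by move: vxy; rewrite !inE !negb_or => /andP[-> ->].
- move=> r; rewrite subst_inst weight_inst => [|u]; last exact: is_term_nth.
  rewrite -[RHS](qG r); apply: eq_weight => // u; rewrite /=.
  by case: eqP => //= _; case: eqP.
Qed.

(** With only shared variables in the environment, every weight that is prescribed is 0, and
    doubling preserves 0. *)
Lemma typed_prom xs M :
  typed (map EBang xs) M -> typed (map EBang xs) (Bang M).
Proof.
case=> [[eG lG cG qG] tM lM]; split=> //; split=> //.
- by move=> x; rewrite lvars_bang.
- by move=> x /cG /= ->.
- by move=> r; rewrite /= qG qvars_bang.
Qed.

Lemma off_delta x xs : x \notin xs -> off xs (delta x) =1 delta x.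
Proof.
by move=> xxs y; rewrite /off /delta; case: ifP => // yxs; case: eqP => // yx;
  rewrite -yx yxs in xxs.
Qed.

Lemma off_delta0 x xs : x \in xs -> off xs (delta x) =1 zero.
Proof.
by move=> xxs y; rewrite /off /delta; case: ifPn => // yxs; case: eqP => // yx;
  rewrite yx xxs in yxs.
Qed.

Lemma off_zero xs : off xs zero =1 zero.
Proof. by move=> y; rewrite /off; case: ifP. Qed.

Lemma cweight_lam p x M :
  cweight x (lam p M) = if x \in pvars p then 0 else cweight x M.
Proof.
rewrite weight_lam; case: ifPn => xp.
  by rewrite -[RHS](weight_zero M); apply: eq_weight => //; apply: off_delta0.
by apply: eq_weight => //; apply: off_delta.
Qed.

Lemma qweight_lam p r M : qweight r (lam p M) = qweight r M.
Proof. by rewrite weight_lam; apply: eq_weight => //; apply: off_zero. Qed.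

(** The item [e] is only required to have the names of [p], so that the lemma serves [lam p] and,
    with [p = PVar x], also [lam_bang x], whose weights are the same by computation. *)
Lemma balanced_bind e G M p :
  item_cvars e = pvars p -> item_qvars e = [::] ->
  balanced (e :: G) (fun x => cweight x M) (fun r => qweight r M) ->
  balanced G (fun x => cweight x (lam p M)) (fun r => qweight r (lam p M)).
Proof.
move=> ep eq0 [/andP[eG /andP[_ pG]] lG cG qG].
have [_ eG' dp _] := is_env_cat [:: e] G eG.
have pE : pvars p = cvars [:: e] by rewrite /cvars /= cats0.
split.
- by rewrite eG'.
- move=> x xG; rewrite cweight_lam ifN.
    by apply: lG; rewrite -cat1s lvars_cat mem_cat xG orbT.
  by rewrite pE; apply: contraL (lvars_sub_cvars _ _ xG); apply: dp.
- move=> x xG; rewrite cweight_lam; case: ifPn => // xp; apply: cG.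
  by rewrite -cat1s cvars_cat mem_cat -pE negb_or xp.
- by move=> r; rewrite qweight_lam qG /qvars /= eq0.
Qed.

Lemma typed_lam G p M : typed (EPat p :: G) M -> typed G (lam p M).
Proof.
case=> bG tM lM; have [/andP[eG /andP[p0 _]] lG _ _] := bG.
have up : uniq (pvars p).
  have [] := is_env_cat [:: EPat p] G eG.
  by rewrite /is_env /= !cats0 => /andP[].
have pp : is_pattern p by rewrite /is_pattern p0.
split; [exact: balanced_bind bG | exact: is_term_lam|].
rewrite linear_binders_lam // lM andbT; apply/allP => x xp.
by rewrite lG // -cat1s lvars_cat mem_cat /lvars /= cats0 xp.
Qed.

Lemma typed_lam_bang G x M : typed (EBang x :: G) M -> typed G (lam_bang x M).
Proof.
case=> bG tM lM; split.
- exact: (@balanced_bind (EBang x) G M (PVar x)).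
- exact: is_term_lam_bang.
- by rewrite /= linear_binders_close.
Qed.

Lemma typed_tuple Gs Ms :
  is_env (flatten Gs) -> Forall2 typed Gs Ms ->
  [/\ balanced (flatten Gs) (fun x => sumn [seq cweight x M | M <- Ms])
        (fun r => sumn [seq qweight r M | M <- Ms]),
      all (is_term 0) Ms & all linear_binders Ms].
Proof.
move=> eG h; elim: h eG => [|G M {}Gs {}Ms [bM tM lM] _ IH] //= eG.
have [_ /IH[bMs tMs lMs] _ _] := is_env_cat _ _ eG.
by rewrite tM lM; split=> //; apply: balanced_cat.
Qed.

Lemma wf_typed G M : wf G M -> typed G M.
Proof.
(* The premises of [wf_tuple] sit inside a [Forall2], where the generated induction principle gives
   no hypothesis; hence a fixpoint on derivations, with a nested one for tuples. *)
move: G M; fix IH 3 => G M; case.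
- by move=> {}G G' {}M GG' /IH; apply: typed_exchange.
- by move=> b; split=> //; split=> // r; rewrite weight_notin_qv.
- by move=> i; split=> //; split=> // r; rewrite weight_notin_qv.
- move=> r; split=> //; split=> // s; rewrite /= /delta inE.
  by rewrite eq_sym.
- move=> x; split=> //; split=> // y; rewrite /= /delta inE eq_sym.
    by move=> ->.
  by case: eqP.
- move=> {}G x {}M eG /IH tM; have [[/andP[_ pG] _ _ _] _ _] := tM.
  apply: typed_sub tM => // y yG.
  by rewrite -cat1s cvars_cat mem_cat yG orbT.
- by move=> {}G x y z {}M eG /IH; apply: typed_contr.
- by move=> xs {}M /IH; apply: typed_prom.
- move=> {}G x {}M /IH tM; have [[/andP[eG pG] _ _ _] _ _] := tM.
  by apply: typed_sub tM => // y yG; rewrite inE yG orbT.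
- move=> {}G xs {}M xs0 /IH tM; have [[/andP[eG pG] _ _ _] _ _] := tM.
  have cE : cvars (map lin xs ++ G) = cvars (EPat (PTup xs) :: G).
    by rewrite cvars_cat cvars_lin.
  have qE : qvars (map lin xs ++ G) = qvars (EPat (PTup xs) :: G).
    by rewrite qvars_cat qvars_lin.
  apply: typed_sub tM => //.
  + by rewrite /is_env -/(cvars _) -/(qvars _) -cE -qE.
  + apply/andP; split; first exact/eqP.
    by move: pG; rewrite /nonempty_patterns all_cat => /andP[].
  + by rewrite lvars_cat lvars_lin.
  + by rewrite cE.
  + by rewrite qE.
- move=> Gs Ms sz eG wMs.
  have tMs : Forall2 typed Gs Ms.
    move: (Gs) (Ms) wMs {sz eG}; fix IHs 3 => _ _ [|G' M' Gs' Ms' wM wMs].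
      exact: Forall2_nil.
    by apply: Forall2_cons; [apply: IH|apply: IHs].
  have [bMs tt ll] := typed_tuple _ _ eG tMs.
  by split=> //; apply/andP.
- by move=> {}G {}M /IH[bM tM lM].
- by move=> {}G p {}M /IH; apply: typed_lam.
- by move=> {}G x {}M /IH; apply: typed_lam_bang.
- move=> G1 G2 M1 M2 eG /IH[b1 t1 l1] /IH[b2 t2 l2].
  split; [exact: balanced_cat|exact/andP|exact/andP].
Qed.

(** * The counting condition is sufficient *)

(** The induction on size runs over environments of this form; the tuple patterns of a given
    environment are regrouped afterwards by [wf_expand]. *)
Definition canon (xs ys rs : seq nat) : env :=
  map lin xs ++ map EBang ys ++ map EQ rs.

Lemma cvars_canon xs ys rs : cvars (canon xs ys rs) = xs ++ ys.
Proof. by rewrite /canon !cvars_cat cvars_lin cvars_bang cvars_q cats0. Qed.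

Lemma lvars_canon xs ys rs : lvars (canon xs ys rs) = xs.
Proof. by rewrite /canon !lvars_cat lvars_lin lvars_bang lvars_q !cats0. Qed.

Lemma qvars_canon xs ys rs : qvars (canon xs ys rs) = rs.
Proof. by rewrite /canon !qvars_cat qvars_lin qvars_bang qvars_q. Qed.

Lemma is_env_canon xs ys rs :
  is_env (canon xs ys rs) = uniq (xs ++ ys) && uniq rs.
Proof. by rewrite /is_env -/(cvars _) -/(qvars _) cvars_canon qvars_canon. Qed.

Lemma balanced_canon xs ys rs wc wq :
  balanced (canon xs ys rs) wc wq <->
  [/\ uniq (xs ++ ys) && uniq rs, forall x, x \in xs -> wc x = 1,
      forall x, x \notin xs ++ ys -> wc x = 0 & forall r, wq r = (r \in rs)].
Proof.
rewrite /balanced is_env_canon lvars_canon cvars_canon qvars_canon.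
have -> : nonempty_patterns (canon xs ys rs).
  rewrite /nonempty_patterns !all_cat; apply/and3P; split.
  - exact: nonempty_patterns_lin.
  - exact: nonempty_patterns_bang.
  - exact: nonempty_patterns_q.
by rewrite andbT.
Qed.

Lemma canon_cat xs ys rs xs' ys' rs' :
  Permutation (canon xs ys rs ++ canon xs' ys' rs')
    (canon (xs ++ xs') (ys ++ ys') (rs ++ rs')).
Proof.
rewrite /canon !map_cat -!catA; apply: Permutation_app_head.
set B := map EBang ys; set Q := map EQ rs; set L := map lin xs'.
set B' := map EBang ys'; set Q' := map EQ rs'.
apply: (@Permutation_trans _ _ (L ++ (B ++ Q) ++ B' ++ Q')).
  rewrite catA; exact: (Permutation_app_swap_app (B ++ Q) L (B' ++ Q')).
apply: Permutation_app_head; rewrite -catA; apply: Permutation_app_head.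
exact: (Permutation_app_swap_app Q B' Q').
Qed.

Lemma Permutation_filterC (T : Type) (a : pred T) s :
  Permutation (filter a s ++ filter (predC a) s) s.
Proof.
elim: s => //= x s IH; case: (a x) => /=; first exact: perm_skip.
exact: Permutation_sym (Permutation_cons_app _ _ _ (Permutation_sym IH)).
Qed.

Lemma Permutation_rem (T : eqType) (x : T) s :
  x \in s -> Permutation s (x :: rem x s).
Proof.
elim: s => //= y s IH; rewrite inE eq_sym; case: eqP => [-> //|_] /= /IH h.
apply: Permutation_trans (perm_swap _ _ _); exact: perm_skip.
Qed.

Lemma Permutation_canon xs ys rs xs' ys' rs' :
  Permutation xs xs' -> Permutation ys ys' -> Permutation rs rs' ->
  Permutation (canon xs ys rs) (canon xs' ys' rs').
Proof.
move=> hx hy hr; apply: Permutation_app; first exact: Permutation_map.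
by apply: Permutation_app; apply: Permutation_map.
Qed.

Lemma wf_weakening ys G M :
  is_env (map EBang ys ++ G) -> wf G M -> wf (map EBang ys ++ G) M.
Proof.
move=> + wM; elim: ys => //= y ys IH eG; apply: wf_weak => //.
by apply: IH; have [] := is_env_cat [:: EBang y] _ eG.
Qed.

(** Each [y] is contracted with [f y] into [f y] itself, which stays available as a target for the
    rest of [Y]. Since [f y] lies outside [Y], the later renamings fix it. *)
Lemma wf_contraction Y ys f G T :
  is_env (map EBang Y ++ map EBang ys ++ G) ->
  (forall y, y \in Y -> f y \in ys) ->
  wf (map EBang Y ++ map EBang ys ++ G) T ->
  wf (map EBang ys ++ G) (rename (fun x => if x \in Y then f x else x) T).
Proof.
elim: Y T => [|y Y IH] T /= eG fY wT; first by rewrite inst_Var.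
have fys : f y \in ys by apply: fY; rewrite inE eqxx.
have [eY eG' _ _] := is_env_cat [:: EBang y] _ eG.
have [_ _ dY _] := is_env_cat (map EBang (y :: Y)) _ eG.
have zY : f y \notin y :: Y.
  apply: contraL fys => zY; move: (dY (f y)).
  by rewrite cvars_bang cvars_cat cvars_bang mem_cat => /(_ zY) /norP[].
pose rest := map EBang Y ++ map EBang (rem (f y) ys) ++ G.
have P : Permutation (map EBang Y ++ map EBang ys ++ G) (EBang (f y) :: rest).
  apply: Permutation_sym; apply: Permutation_trans (Permutation_middle _ _ _) _.
  apply: Permutation_app_head.
  exact: (Permutation_app_tail G (Permutation_sym
    (Permutation_map EBang (Permutation_rem _ _ _ fys)))).
have wz : wf (map EBang Y ++ map EBang ys ++ G)
    (subst [:: y; f y] [:: Var (f y); Var (f y)] T).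
  apply: wf_exchange (Permutation_sym P) _; apply: wf_contr.
    by rewrite -(is_env_Permutation _ _ P).
  exact: wf_exchange (perm_skip _ P) wT.
have := IH _ eG' (fun z hz => fY z (mem_behead (s := y :: Y) hz)) wz.
rewrite subst_inst inst_inst; congr wf; apply: eq_inst => x _ /=.
move: zY; rewrite inE negb_or => /andP[zy zY].
rewrite inE [y == x]eq_sym; case: eqP => [->|_] /=; first by rewrite (negPf zY).
case: eqP => [<-|_] /=; first by rewrite (negPf zY).
by [].
Qed.

(** * Renaming shared variables apart and merging them again *)

Section Completeness.

Variable n : nat.
Hypothesis IHn : forall xs ys rs M,
  term_size M <= n -> typed (canon xs ys rs) M -> wf (canon xs ys rs) M.

Definition copy_name N i (ys : seq nat) (x : nat) : nat :=
  if x \in ys then x + N * i else x.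

Lemma rename_copyK N i ys M :
  (forall x, x \in fv M -> x < N) ->
  rename (modn^~ N) (rename (copy_name N i ys) M) = M.
Proof.
move=> hM; rewrite inst_inst -[RHS]inst_Var; apply: eq_inst => x xM /=.
rewrite /copy_name; case: ifP => _; first rewrite addnC mulnC modnMDl.
  by rewrite modn_small ?hM.
by rewrite modn_small ?hM.
Qed.

Lemma cweight_rename v f M :
  cweight v (rename f M) = weight (fun u => delta v (f u)) zero zero M.
Proof. by rewrite weight_inst. Qed.

Lemma qweight_rename r f M : qweight r (rename f M) = qweight r M.
Proof. by rewrite weight_inst. Qed.

(** Linear names are kept and lie below [N], while [0 < i] puts every copy at [N] or above, so they
    cannot clash. *)
Lemma typed_copy N i xs ys rs M :
  0 < i -> (forall x, x \in xs ++ ys -> x < N) ->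
  typed (canon xs ys rs) M ->
  typed (canon xs [seq y + N * i | y <- ys] rs) (rename (copy_name N i ys) M).
Proof.
move=> i0 ltN [/balanced_canon[/andP[uxy urs] lG cG qG] tM lM].
move: uxy; rewrite cat_uniq => /and3P[uxs dxy uys].
have xNy x : x \in xs -> x \notin ys.
  by move=> xxs; apply/negP => xys; case/hasP: dxy; exists x.
have lex x y : x \in xs -> x < y + N * i.
  by move=> xxs; have := ltN x; rewrite mem_cat xxs => /(_ isT); nia.
split; last 2 first.
- exact: is_term_inst.
- exact: linear_binders_inst.
apply/balanced_canon; split.
- rewrite urs andbT cat_uniq uxs map_inj_uniq ?uys ?andbT => [|y z]; last by lia.
  by apply/hasPn => _ /mapP[y _ ->]; apply/negP => /(lex _ y); rewrite ltnn.
- move=> x xxs; rewrite cweight_rename -(lG x xxs).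
  apply: eq_weight => // y; rewrite /delta /copy_name; case: ifP => // yys.
  have /negPf-> : y + N * i != x by have := lex x y xxs; lia.
  by case: eqP => // yx; move: (xNy x xxs); rewrite -yx yys.
- move=> x; rewrite mem_cat negb_or => /andP[xxs xys].
  have yx y : (copy_name N i ys y == x) = (y \notin ys) && (y == x).
    rewrite /copy_name; case: (boolP (y \in ys)) => //= yys.
    apply/eqP => yE; case/negP: xys; rewrite -yE.
    exact: (map_f (fun y => y + N * i)).
  rewrite cweight_rename; case: (boolP (x \in ys)) => xy.
    rewrite -[RHS](weight_zero M); apply: eq_weight => // y; rewrite /delta yx.
    by case: eqP => [->|_]; rewrite ?xy ?andbF.
  rewrite -[RHS](cG x); last by rewrite mem_cat negb_or xxs.
  apply: eq_weight => // y; rewrite /delta yx; case: eqP => [->|_]; first by rewrite xy.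
  by rewrite andbF.
- by move=> r; rewrite qweight_rename.
Qed.

(* Component number [i] uses the copy [y + N * i] of a shared variable [y < N],
   so that the components live in disjoint environments and all copies are
   merged back by reduction modulo [N]. *)
Lemma split_components N i xs ys rs Ms :
  0 < i -> (forall x, x \in xs ++ ys -> x < N) ->
  sumn (map term_size Ms) <= n ->
  balanced (canon xs ys rs) (fun x => sumn [seq cweight x M | M <- Ms])
    (fun r => sumn [seq qweight r M | M <- Ms]) ->
  all (is_term 0) Ms -> all linear_binders Ms ->
  exists Gs Ms' Y,
    [/\ Forall2 wf Gs Ms', Permutation (flatten Gs) (canon xs Y rs),
        map (rename (modn^~ N)) Ms' = Ms, uniq Y &
        forall y, y \in Y -> N * i <= y /\ y %% N \in ys].
Proof.
elim: Ms i xs rs => [|M Ms IHMs] i xs rs i0 ltN /= sz.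
  move=> /balanced_canon[_ lG _ qG] _ _; exists [::], [::], [::].
  (* Without components all weights are 0, which leaves no linear and no quantum variable. *)
  have -> : xs = [::] by case: (xs) lG => // x s /(_ x); rewrite inE eqxx => /(_ isT).
  have -> : rs = [::].
    by case: (rs) qG => // x s /(_ x); rewrite inE eqxx.
  by split=> //; exact: Forall2_nil.
move=> /balanced_canon[/andP[uxy urs] lG cG qG] /andP[tM tMs] /andP[lM lMs].
move: uxy; rewrite cat_uniq => /and3P[uxs dxy uys].
(* The weights of a linear or quantum variable add up to 1 over the components, so exactly one
   component has it; [a] and [b] select those of [M]. *)
pose a x := cweight x M == 1; pose b r := qweight r M == 1.
have ufilter s : uniq (filter s xs ++ ys).
  rewrite cat_uniq filter_uniq //= uys andbT.
  apply: contra dxy => /hasP[x xys]; rewrite /= mem_filter => /andP[_ xxs].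
  by apply/hasP; exists x.
have ltNs s x : x \in filter s xs ++ ys -> x < N.
  rewrite mem_cat mem_filter => h; apply: ltN; rewrite mem_cat.
  by case/orP: h => [/andP[_ ->]|->]; rewrite ?orbT.
have bM : balanced (canon (filter a xs) ys (filter b rs))
    (fun x => cweight x M) (fun r => qweight r M).
  apply/balanced_canon; split.
  - by rewrite ufilter filter_uniq.
  - by move=> x; rewrite mem_filter => /andP[/eqP].
  - move=> x; rewrite mem_cat mem_filter negb_or negb_and => /andP[h xys].
    case: (boolP (x \in xs)) h => [xxs|xxs _].
      by rewrite orbF /a; have := lG x xxs; lia.
    by have := cG x; rewrite mem_cat negb_or xxs xys => /(_ isT); lia.
  - move=> r; rewrite mem_filter /b; have := qG r.
    by case: (r \in rs) => /=; lia.
have bMs : balanced (canon (filter (predC a) xs) ys (filter (predC b) rs))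
    (fun x => sumn [seq cweight x M | M <- Ms])
    (fun r => sumn [seq qweight r M | M <- Ms]).
  apply/balanced_canon; split.
  - by rewrite ufilter filter_uniq.
  - move=> x; rewrite mem_filter => /andP[/= h /lG]; move: h; rewrite /a; lia.
  - move=> x; rewrite mem_cat mem_filter negb_or negb_and => /andP[h xys].
    case: (boolP (x \in xs)) h => [xxs|xxs _].
      by rewrite orbF /= /a; have := lG x xxs; lia.
    by have := cG x; rewrite mem_cat negb_or xxs xys => /(_ isT); lia.
  - move=> r; rewrite mem_filter /= /b; have := qG r.
    by case: (r \in rs) => /=; lia.
have szMs : sumn (map term_size Ms) <= n by apply: leq_trans sz; apply: leq_addl.
have szM : term_size M <= n by apply: leq_trans sz; apply: leq_addr.
(* The remaining components start at [i.+1], so their copies are at least [N * i.+1], above all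
   copies used for [M]. *)
have [Gs [Ms' [Y [wMs PY rMs uY hY]]]] :=
  IHMs i.+1 _ _ isT (ltNs _) szMs bMs tMs lMs.
have tM' : typed (canon (filter a xs) ys (filter b rs)) M by [].
have := typed_copy N i _ _ _ _ i0 (ltNs a) tM'.
move/IHn; rewrite term_size_rename => /(_ szM) wM.
exists (canon (filter a xs) [seq y + N * i | y <- ys] (filter b rs) :: Gs).
exists (rename (copy_name N i ys) M :: Ms'), ([seq y + N * i | y <- ys] ++ Y).
have yltN y : y \in ys -> y < N by move=> yys; apply: ltN; rewrite mem_cat yys orbT.
split.
- exact: Forall2_cons.
- apply: Permutation_trans (Permutation_app_head _ PY) _.
  apply: Permutation_trans (canon_cat _ _ _ _ _ _) _.
  apply: Permutation_canon; first exact: Permutation_filterC.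
    exact: Permutation_refl.
  exact: Permutation_filterC.
- rewrite /= rMs rename_copyK // => x xM; apply: (ltNs a); apply: contraLR xM => xG.
  apply: weight_fv; case/balanced_canon: bM => _ _ h _; exact: h.
- rewrite cat_uniq uY andbT map_inj_uniq ?uys => [|y z]; last by lia.
  apply/hasPn => y /hY[yi _]; apply/negP => /mapP[z /yltN zN yE].
  by move: yi; rewrite yE mulnS; lia.
- move=> y; rewrite mem_cat => /orP[/mapP[z zys ->]|/hY[yi ->]].
    by rewrite leq_addl addnC mulnC modnMDl modn_small // yltN.
  by split=> //; apply: leq_trans yi; rewrite leq_mul.
Qed.

(** The environment of [T] has only the copies, so weakening first adds the originals [ys] as
    targets of the contractions. *)
Lemma merge_copies N xs ys Y rs T :
  (forall x, x \in xs ++ ys -> x < N) -> uniq ys ->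
  uniq (xs ++ ys) -> uniq rs -> uniq Y ->
  (forall y, y \in Y -> N <= y /\ y %% N \in ys) ->
  wf (canon xs Y rs) T -> wf (canon xs ys rs) (rename (modn^~ N) T).
Proof.
move=> ltN uys uxy urs uY hY wT.
have P Z : Permutation (canon xs Z rs) (map EBang Z ++ map lin xs ++ map EQ rs).
  exact: Permutation_app_swap_app.
pose G := map EBang ys ++ map lin xs ++ map EQ rs.
have PY : Permutation (map EBang Y ++ G)
    (map EBang ys ++ map EBang Y ++ map lin xs ++ map EQ rs).
  exact: Permutation_app_swap_app.
have eG : is_env (map EBang Y ++ G).
  rewrite /is_env -/(cvars _) -/(qvars _) /G !cvars_cat !qvars_cat.
  rewrite !cvars_bang !qvars_bang cvars_lin qvars_lin cvars_q qvars_q /= cats0 urs.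
  rewrite andbT cat_uniq uY uniq_catC uxy andbT.
  apply/hasPn => x; rewrite mem_cat orbC -mem_cat => /ltN xN.
  by apply/negP => /hY[]; lia.
have wY : wf (map EBang Y ++ G) T.
  apply: wf_exchange (Permutation_sym PY) _; apply: wf_weakening.
    by rewrite -(is_env_Permutation _ _ PY).
  exact: wf_exchange (P Y) wT.
have := wf_contraction Y ys (modn^~ N) _ T eG (fun y yY => (hY y yY).2) wY.
move=> /(wf_exchange (Permutation_sym (P ys))); congr wf; apply: eq_inst => x xT /=.
(* Contraction renames only [Y], so reduction modulo [N] has to fix the other free variables of [T]:
   by [wf_typed] they belong to [xs], hence are below [N]. *)
case: ifPn => // xY; rewrite modn_small // ltN //.
have [/balanced_canon[_ _ cG _] _ _] := wf_typed _ _ wT.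
apply: contraLR xT => xG; apply: weight_fv; apply: cG; rewrite mem_cat negb_or xY andbT.
by apply: contra xG => h; rewrite mem_cat h.
Qed.

End Completeness.

(** * Derivations in canonical environments, by term constructor *)

Lemma uniq_all_eq (T : eqType) (x : T) s :
  uniq s -> {in s, forall y, y = x} -> s = [::] \/ s = [:: x].
Proof.
case: s => [|y [|z s]] /= u h; first by left.
  by right; rewrite (h y) // inE.
have yx : y = x by apply: h; rewrite inE eqxx.
have zx : z = x by apply: h; rewrite !inE eqxx orbT.
by rewrite yx zx inE eqxx in u.
Qed.

Lemma ltn_fresh xs x : x \in xs -> x < (\max_(y <- xs) y).+1.
Proof. by move=> xxs; rewrite ltnS; apply: (leq_bigmax_seq (F := id)). Qed.

(** Weight 1 in [Var x] forces every linear variable to be [x]: either [x] is the only linear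
    variable, or it is shared and comes from dereliction. *)
Lemma wf_var_canon xs ys rs x :
  typed (canon xs ys rs) (Var x) -> wf (canon xs ys rs) (Var x).
Proof.
case=> /balanced_canon[/andP[uxy urs] lG cG qG] _ _.
move: (uxy); rewrite cat_uniq => /and3P[uxs _ _].
have rs0 : rs = [::].
  by case: (rs) qG => // r s /(_ r); rewrite inE eqxx.
have eG : is_env (canon xs ys rs) by rewrite is_env_canon uxy.
have xE y : y \in xs -> y = x.
  by move=> /lG; rewrite /= /delta; case: eqP.
have xG : x \in xs ++ ys.
  by apply/negPn/negP => /cG; rewrite /= /delta eqxx.
rewrite rs0 in eG *.
case: (uniq_all_eq _ x xs uxs xE) => xs0; rewrite xs0 in eG xG *.
  have P := Permutation_rem _ _ _ xG.
  rewrite /canon /= cats0 in eG *.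
  apply: wf_exchange (Permutation_sym (Permutation_map EBang P)) _.
  apply: wf_der; apply: (wf_exchange (G := map EBang (rem x ys) ++ [:: lin x])).
    exact: Permutation_sym (Permutation_cons_append _ _).
  apply: wf_weakening (wf_var _).
  move: eG; rewrite /is_env -!/(cvars _) -!/(qvars _) cvars_cat qvars_cat.
  rewrite !cvars_bang !qvars_bang cats0 /= andbT => uys.
  have /perm_uniq := perm_to_rem xG; rewrite uys => /esym /= /andP[xr ur].
  by rewrite andbT cat_uniq ur /= orbF xr.
rewrite /canon /= cats0 in eG *.
apply: wf_exchange (Permutation_sym (Permutation_cons_append _ _)) _.
apply: wf_weakening (wf_var _).
by rewrite -(is_env_Permutation _ _ (Permutation_cons_append _ _)).
Qed.

Lemma canon_weightless xs ys rs M :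
  (forall x, cweight x M = 0) -> (forall r, qweight r M = 0) ->
  balanced (canon xs ys rs) (fun x => cweight x M) (fun r => qweight r M) ->
  [/\ xs = [::], rs = [::] & is_env (map EBang ys ++ [::])].
Proof.
move=> c0 q0 /balanced_canon[u lG _ qG].
have xs0 : xs = [::].
  by case: (xs) lG => // x s /(_ x); rewrite inE eqxx c0 => /(_ isT).
have rs0 : rs = [::].
  by case: (rs) qG => // r s /(_ r); rewrite inE eqxx q0.
by rewrite -(is_env_canon xs ys rs) xs0 rs0 in u.
Qed.

Lemma wf_qvar_canon xs ys rs r :
  typed (canon xs ys rs) (QVar r) -> wf (canon xs ys rs) (QVar r).
Proof.
case=> /balanced_canon[u lG _ qG] _ _.
have xs0 : xs = [::].
  by case: (xs) lG => // x s /(_ x); rewrite inE eqxx /= => /(_ isT).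
have rs0 : rs = [:: r].
  have /andP[_ urs] := u.
  case: (uniq_all_eq _ r rs urs) => [s|rs0|] //.
    by move=> srs; have := qG s; rewrite srs /= /delta; case: eqP.
  by have := qG r; rewrite rs0 /= /delta eqxx.
rewrite xs0 rs0 in u *; apply: wf_weakening (wf_qvar r).
by rewrite -[is_env _]/(is_env (canon [::] ys [:: r])) is_env_canon.
Qed.

Lemma wf_app_canon n xs ys rs M N :
  (forall xs ys rs M,
     term_size M <= n -> typed (canon xs ys rs) M -> wf (canon xs ys rs) M) ->
  term_size M + term_size N <= n ->
  typed (canon xs ys rs) (App M N) -> wf (canon xs ys rs) (App M N).
Proof.
move=> IHn sz [bG /andP[tM tN] /andP[lM lN]].
have /balanced_canon[/andP[uxy urs] _ _ _] := bG.
move: (uxy); rewrite cat_uniq => /and3P[uxs _ uys].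
have ltb x : x \in xs ++ ys -> x < (\max_(y <- xs ++ ys) y).+1 by exact: ltn_fresh.
set b := _.+1 in ltb.
(* An application is split like a pair. As [b] exceeds all names of the environment, numbering the
   components from 1 puts the copies at [b] or above. *)
have [||||Gs [Ms' [Y [wMs PY rMs uY hY]]]] :=
  split_components n IHn b 1 xs ys rs [:: M; N] isT ltb.
- by rewrite /= addn0.
- by apply: eq_balanced bG => x; rewrite /= addn0.
- by apply/and3P.
- by apply/and3P.
have {}hY y : y \in Y -> b <= y /\ y %% b \in ys.
  by move=> /hY; rewrite muln1.
move: PY rMs; case: wMs => // G1 M1 _ _ w1 [] // G2 M2 _ _ w2 [] //= PY [<- <-].
rewrite cats0 in PY.
apply: (merge_copies b xs ys Y rs (App M1 M2)) => //.
apply: (wf_exchange PY); apply: wf_app => //.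
rewrite (is_env_Permutation _ _ PY) is_env_canon urs andbT cat_uniq uxs uY andbT.
apply/hasPn => y /hY[by_ _]; apply/negP => yxs.
by have := ltb y; rewrite mem_cat yxs => /(_ isT); lia.
Qed.

Lemma wf_tuple_canon n xs ys rs Ms :
  (forall xs ys rs M,
     term_size M <= n -> typed (canon xs ys rs) M -> wf (canon xs ys rs) M) ->
  sumn (map term_size Ms) <= n ->
  typed (canon xs ys rs) (Tup Ms) -> wf (canon xs ys rs) (Tup Ms).
Proof.
move=> IHn sz [bG /andP[szM tM] /andP[_ lM]].
have /balanced_canon[/andP[uxy urs] _ _ _] := bG.
move: (uxy); rewrite cat_uniq => /and3P[uxs _ uys].
have ltb x : x \in xs ++ ys -> x < (\max_(y <- xs ++ ys) y).+1 by exact: ltn_fresh.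
set b := _.+1 in ltb.
have [Gs [Ms' [Y [wMs PY rMs uY hY]]]] :=
  split_components n IHn b 1 xs ys rs Ms isT ltb sz bG tM lM.
have {}hY y : y \in Y -> b <= y /\ y %% b \in ys.
  by move=> /hY; rewrite muln1.
rewrite -rMs size_map in szM; rewrite -rMs.
apply: (merge_copies b xs ys Y rs (Tup Ms')) => //.
apply: (wf_exchange PY); apply: wf_tuple => //.
rewrite (is_env_Permutation _ _ PY) is_env_canon urs andbT cat_uniq uxs uY andbT.
apply/hasPn => y /hY[by_ _]; apply/negP => yxs.
by have := ltb y; rewrite mem_cat yxs => /(_ isT); lia.
Qed.

Lemma wf_lam_canon n xs ys rs s M :
  (forall xs ys rs M,
     term_size M <= n -> typed (canon xs ys rs) M -> wf (canon xs ys rs) M) ->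
  term_size M <= n ->
  typed (canon xs ys rs) (Lam s M) -> wf (canon xs ys rs) (Lam s M).
Proof.
move=> IHn sz [/balanced_canon[/andP[uxy urs] lG cG qG] tL lL].
have /andP[s0 tM] : is_term 0 (Lam s M) := tL.
have ltb x : x \in (xs ++ ys) ++ fv M -> x < (\max_(y <- (xs ++ ys) ++ fv M) y).+1.
  exact: ltn_fresh.
(* The maximum includes the free names of [M], so [zs] is fresh for the body as well as for the
   environment. *)
set b := _.+1 in ltb; pose zs := iota b (arity s).
have zsP z : z \in zs -> b <= z by rewrite mem_iota => /andP[].
have uz : uniq zs by exact: iota_uniq.
pose p := if s is SVar then PVar b else PTup zs.
have pz : pvars p = zs by rewrite /p /zs; case: (s).
have sp : shape_of p = s by rewrite /p /zs; case: (s) => //= k; rewrite size_iota.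
have pM : is_pattern p.
  by rewrite /is_pattern pz uz andbT -size_eq0 size_iota -lt0n.
pose M0 := open 0 zs M.
have tM0 : is_term 0 M0 by apply: is_term_open; rewrite size_iota.
have LE : Lam s M = lam p M0.
  rewrite /lam sp pz close_open ?size_iota //.
  apply/hasPn => z /zsP bz; apply/negP => zM.
  have := ltb z; rewrite mem_cat [z \in fv M]zM orbT => /(_ isT); lia.
have zxy z : z \in zs -> z \notin xs ++ ys.
  move=> /zsP bz; apply/negP => zM.
  by have := ltb z; rewrite mem_cat zM => /(_ isT); lia.
rewrite LE in lG cG qG lL *; apply: wf_lam.
move: lL; rewrite linear_binders_lam ?pz // => /andP[/allP zM lM0].
(* The names of the opened pattern enter as separate linear variables; [linear_binders] supplies
   their weight 1. *)
have w : wf (canon (zs ++ xs) ys rs) M0.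
  apply: IHn; first by rewrite term_size_open.
  split=> //; apply/balanced_canon; split.
  - rewrite urs andbT -catA cat_uniq uz uxy andbT.
    by apply/hasPn => x; apply: contraL => /zxy.
  - move=> x; rewrite mem_cat => /orP[/zM /eqP //|xxs].
    have := lG x xxs; rewrite cweight_lam pz ifN //.
    by apply: contraL (xxs) => /zxy; rewrite mem_cat => /norP[].
  - move=> x; rewrite -catA mem_cat negb_or => /andP[xz xxy].
    by have := cG x xxy; rewrite cweight_lam pz ifN.
  - by move=> r; have := qG r; rewrite qweight_lam.
have zs0 : zs <> [::] by move=> z0; move: s0; rewrite -(size_iota b (arity s)) -/zs z0.
(* For a tuple shape, [wf_pat] regroups [zs] into one pattern; for [SVar] the list is a singleton
   and already has the right form. *)
move: w zs0; rewrite /canon map_cat -catA /p /zs; move: (M0) => N0.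
by case: (s) => //= k w k0; apply: wf_pat.
Qed.

(** As for a pattern, except that the opened name joins the shared variables, where any weight is
    allowed. *)
Lemma wf_lam_bang_canon n xs ys rs M :
  (forall xs ys rs M,
     term_size M <= n -> typed (canon xs ys rs) M -> wf (canon xs ys rs) M) ->
  term_size M <= n ->
  typed (canon xs ys rs) (LamBang M) -> wf (canon xs ys rs) (LamBang M).
Proof.
move=> IHn sz [/balanced_canon[/andP[uxy urs] lG cG qG] tM lM].
have ltb x : x \in (xs ++ ys) ++ fv M -> x < (\max_(y <- (xs ++ ys) ++ fv M) y).+1.
  exact: ltn_fresh.
set b := _.+1 in ltb; pose M0 := open 0 [:: b] M.
have bM : b \notin (xs ++ ys) ++ fv M by apply/negP => /ltb; rewrite ltnn.
move: bM; rewrite mem_cat negb_or => /andP[bxy bM].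
have LE : LamBang M = lam_bang b M0.
  by rewrite /lam_bang close_open //= orbF.
have cE x : cweight x (lam_bang b M0) = if x == b then 0 else cweight x M0.
  by rewrite -[LHS]/(cweight x (lam (PVar b) M0)) cweight_lam inE.
rewrite LE in lG cG qG *; apply: wf_lam_bang.
have w : wf (canon xs (b :: ys) rs) M0.
  apply: IHn; first by rewrite term_size_open.
  split.
  - apply/balanced_canon; split.
    + rewrite urs andbT -cat1s uniq_catCA /= bxy /=; exact: uxy.
    + move=> x xxs; have := lG x xxs; rewrite cE ifN //.
      by apply: contraNneq bxy => <-; rewrite mem_cat xxs.
    + move=> x; rewrite mem_cat inE orbCA negb_or -mem_cat => /andP[xb xxy].
      by have := cG x xxy; rewrite cE ifN.
    + by move=> r; have := qG r;
        rewrite -[qweight r _]/(qweight r (lam (PVar b) M0)) qweight_lam.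
  - exact: is_term_open.
  - by move: lM; rewrite -(linear_binders_close 0 [:: b] M0) -/(lam_bang b M0) LE.
apply: wf_exchange w; exact: Permutation_sym (Permutation_middle _ _ _).
Qed.

Lemma wf_canon xs ys rs M :
  typed (canon xs ys rs) M -> wf (canon xs ys rs) M.
Proof.
have [n] := ubnPleq (term_size M); elim: n xs ys rs M => [|n IHn] xs ys rs M.
  by case: M => /=; lia.
case: M => [i|x|r|M|b|i|M|M N|Ms|M|s M] /=; rewrite ?ltnS => sz tG.
- by case: tG.
- exact: wf_var_canon.
- exact: wf_qvar_canon.
- have [bG tM lM] := tG; have /balanced_canon[u lG cG qG] := bG.
  (* The weights of a banged term are even, whereas a linear or quantum variable would have weight
     1. *)
  have xs0 : xs = [::].
    by case: (xs) lG => // x s /(_ x); rewrite inE eqxx /= => /(_ isT); lia.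
  have rs0 : rs = [::].
    by case: (rs) qG => // r s /(_ r); rewrite inE eqxx /=; lia.
  rewrite xs0 rs0 /canon /= cats0; apply: wf_prom.
  have := IHn [::] ys [::] M sz; rewrite /canon /= cats0; apply.
  rewrite -[map _ _]cats0; split=> //; apply/(balanced_canon [::] ys [::]).
  rewrite xs0 rs0 in u lG cG qG; split=> //.
    by move=> x /cG /=; lia.
  by move=> r; have /= := qG r; lia.
- have [|||-> -> eG] := canon_weightless xs ys rs (Bit b) => //.
    by case: tG.
  exact: wf_weakening eG (wf_bit b).
- have [|||-> -> eG] := canon_weightless xs ys rs (Gate i) => //.
    by case: tG.
  exact: wf_weakening eG (wf_gate i).
- by apply: wf_new; apply: IHn.
- exact: wf_app_canon IHn sz tG.
- exact: wf_tuple_canon IHn sz tG.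
- exact: wf_lam_bang_canon IHn sz tG.
- exact: wf_lam_canon IHn sz tG.
Qed.

(** * Arbitrary environments and subject reduction *)

Definition bvars (G : env) : seq nat :=
  flatten (map (fun e => if e is EBang x then [:: x] else [::]) G).

(** The list [H] is general so that the variables of the head item can be parked there while the
    tail is treated; afterwards exchange returns them to the front, where [wf_pat] can regroup a
    tuple. *)
Lemma wf_expand G H M :
  nonempty_patterns G ->
  wf (canon (lvars G) (bvars G) (qvars G) ++ H) M -> wf (G ++ H) M.
Proof.
elim: G H => [|e G IH] H //= /andP[e0 pG].
case: e e0 => [[x|xs]|x|r] /= e0 w.
- apply: wf_exchange (Permutation_sym (Permutation_middle _ _ _)) _.
  apply: IH => //; apply: wf_exchange w; exact: Permutation_middle (canon _ _ _) H _.
- apply: wf_pat; first exact/eqP.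
  have P : Permutation (canon (xs ++ lvars G) (bvars G) (qvars G) ++ H)
      (canon (lvars G) (bvars G) (qvars G) ++ map lin xs ++ H).
    pose C := canon (lvars G) (bvars G) (qvars G).
    have : Permutation (map lin xs ++ C ++ H) (C ++ map lin xs ++ H).
      exact: Permutation_app_swap_app.
    by rewrite /C /canon map_cat -!catA.
  apply: wf_exchange (Permutation_app_swap_app G _ _) _; apply: IH => //.
  exact: wf_exchange P w.
- apply: wf_exchange (Permutation_sym (Permutation_middle _ _ _)) _.
  have P : Permutation (canon (lvars G) (x :: bvars G) (qvars G) ++ H)
      (EBang x :: canon (lvars G) (bvars G) (qvars G) ++ H).
    rewrite /canon -!catA; apply: Permutation_sym.
    exact: (Permutation_middle (map lin (lvars G))
      (map EBang (bvars G) ++ map EQ (qvars G) ++ H) (EBang x)).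
  apply: IH => //; apply: (wf_exchange _ (wf_exchange P w)).
  exact: (Permutation_middle (canon _ _ _)).
- apply: wf_exchange (Permutation_sym (Permutation_middle _ _ _)) _.
  have P : Permutation (canon (lvars G) (bvars G) (r :: qvars G) ++ H)
      (EQ r :: canon (lvars G) (bvars G) (qvars G) ++ H).
    rewrite /canon !catA -[X in Permutation X _]catA; apply: Permutation_sym.
    rewrite -[X in Permutation (_ :: X) _]catA.
    exact: (Permutation_middle (map lin (lvars G) ++ map EBang (bvars G))
      (map EQ (qvars G) ++ H) (EQ r)).
  apply: IH => //; apply: (wf_exchange _ (wf_exchange P w)).
  exact: (Permutation_middle (canon _ _ _)).
Qed.

Lemma perm_cvars G : perm_eq (cvars G) (lvars G ++ bvars G).
Proof.
elim: G => // -[p|x|r] G IH //=.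
- by rewrite -catA perm_cat2l.
- rewrite -[cvars _]/(x :: cvars G) -[bvars _]/(x :: bvars G).
  by rewrite perm_sym (perm_catCA (lvars G) [:: x]) perm_cons perm_sym.
Qed.

Lemma typed_wf G M : typed G M -> wf G M.
Proof.
case=> [[/andP[eG pG] lG cG qG] tM lM].
rewrite -[G]cats0; apply: wf_expand => //; rewrite cats0.
apply: wf_canon; split=> //; apply/balanced_canon; split=> //.
- by rewrite -(perm_uniq (perm_cvars G)).
- by move=> x; rewrite -(perm_mem (perm_cvars G)); apply: cG.
Qed.

Lemma sum_delta (r : nat) s : uniq s -> \sum_(x <- s) delta r x = (r \in s).
Proof.
move=> us; rewrite -(count_uniq_mem r us) -sum1_count [RHS]big_mkcond.
by apply: eq_bigr => x _; rewrite /delta /=; case: (x == r).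
Qed.

Local Open Scope fset_scope.

Theorem mainTheorem1 (R : realType) (n : nat -> nat)
    (U : forall i : nat, 'M[R[i]%C]_(2 ^ n i))
    (hU : effective_unitaries U)
    (G : env) (M : term)
    (QV : {fset nat}) (Q : hilbert R QV)
    (QV' : {fset nat}) (Q' : hilbert R QV') (M' : term) :
  wf G M ->
  red U (Preconf QV Q M) (Preconf QV' Q' M') ->
  wf (G ++ [seq EQ r | r <- enum_fset (QV' `\` QV)]) M'.
Proof.
move=> /wf_typed [[/andP[eG pG] lG cG qG] tM lM] [a [[qvM _] st]].
have [_ /= tM' lM' wM'] := step_weight _ _ _ _ _ _ st lM.
set new := enum_fset (QV' `\` QV) in wM' *.
have unew : uniq new by exact: fset_uniq.
(* With [zero] on quantum variables, the created ones contribute nothing. *)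
have cM' x : cweight x M <= 1 -> cweight x M' = cweight x M.
  by move/wM' => ->; rewrite big1 // addn0.
(* A quantum variable of [G] has weight 1 in [M], so it occurs there and already belongs to [QV];
   the extended environment therefore repeats no name. *)
have newG r : r \in qvars G -> r \notin new.
  move=> rG; rewrite /new inE negb_and negbK; apply/orP; left; apply: qvM.
  by apply: contraT => /weight_notin_qv; rewrite qG rG.
apply: typed_wf; split=> //; split.
- rewrite /nonempty_patterns all_cat [all _ G]pG.
  rewrite [all _ _](nonempty_patterns_q new) andbT /is_env -/(cvars _) -/(qvars _).
  rewrite cvars_cat qvars_cat cvars_q qvars_q cats0.
  have /andP[-> uq] := eG; rewrite cat_uniq unew uq /= !andbT.
  by apply/hasPn => r; apply: contraL => /newG.
- by move=> x; rewrite lvars_cat lvars_q cats0 => /lG xM; rewrite cM' xM.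
- by move=> x; rewrite cvars_cat cvars_q cats0 => /cG xM; rewrite cM' xM.
(* The weight of [r] in [M] is a Boolean, hence at most 1, and the sum over the created variables
   counts [r] once if it is new. *)
- move=> r; rewrite wM' ?qG ?leq_b1 // sum_delta // qvars_cat qvars_q mem_cat.
  by case: (boolP (r \in qvars G)) => [/newG /negPf ->|].
Qed.
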